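(* Let $d\ge 2$ be an integer, let $0<H\le 1/2$, and let $(S_H(\eta))_{\eta\in\mathbb{S}_{d-1}}$ be spherical fractional Brownian motion with Hurst parameter $H$. Then $$\mathbb{P}\Big(\sup_{\eta\in\mathbb{S}_{d-1}} S_H(\eta)<\varepsilon\Big)=\varepsilon^{\frac{d-1}{H}+o(1)},\qquad \text{as } \varepsilon\searrow 0,$$ i.e. $\lim_{\varepsilon\searrow 0}\frac{1}{\log\varepsilon}\log \mathbb{P}\big(\sup_{\eta\in\mathbb{S}_{d-1}} S_H(\eta)<\varepsilon\big)=\frac{d-1}{H}$.
   Context: $\mathbb{S}_{d-1}=\{\eta\in\mathbb{R}^d:\|\eta\|_2=1\}$, with geodesic distance $d(\eta,\zeta)=\arccos(\langle\eta,\zeta\rangle)$ (the letter $d$ denotes both the dimension and, with two arguments, this distance). $O\in\mathbb{S}_{d-1}$ is an arbitrary fixed point. Spherical fractional Brownian motion with Hurst parameter $H\in(0,1/2]$ is a continuous, centred Gaussian process $(S_H(\eta))_{\eta\in\mathbb{S}_{d-1}}$ with covariance $$\mathbb{E}[S_H(\eta)S_H(\zeta)]=\tfrac12\big(d(\eta,O)^{2H}+d(\zeta,O)^{2H}-d(\eta,\zeta)^{2H}\big),\qquad \eta,\zeta\in\mathbb{S}_{d-1};$$ such a process exists for every $0<H\le 1/2$. *)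

(* Defs.v *)
From mathcomp Require Import all_boot all_order all_algebra.
From mathcomp Require Import all_classical all_reals all_analysis.

Set Implicit Arguments.
Unset Strict Implicit.
Unset Printing Implicit Defensive.

Import Order.TTheory GRing.Theory Num.Theory.
Import numFieldNormedType.Exports.

Local Open Scope classical_set_scope.
Local Open Scope ring_scope.

Section sphere.
Context {R : realType}.

Definition dotprod (d : nat) (x y : 'rV[R]_d) : R :=
  \sum_(i < d) x 0 i * y 0 i.

(* The norm `|x| of the library on 'rV_d is the sup norm, hence norm2. *)
Definition norm2 (d : nat) (x : 'rV[R]_d) : R := Num.sqrt (dotprod x x).

End sphere.

(* The unit sphere of R^d, of dimension d - 1.  Used as a type, it carries the
   topology induced by 'rV[R]_d. *)
Definition sphere (R : realType) (d : nat) : set 'rV[R]_d :=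
  [set x | norm2 x = 1].
Arguments sphere : clear implicits.

Definition geodist (R : realType) (d : nat) (x y : sphere R d) : R :=
  acos (dotprod (set_val x) (set_val y)).

(* The case s = 0 must be given separately, as a Dirac mass: the library's
   normal_prob m 0 is the uniform law on [0, 1]. *)
Definition gaussian_law (R : realType) (mu : set R -> \bar R) : Prop :=
  exists m s : R, 0 <= s /\
    forall A : set R, measurable A ->
      mu A = if s == 0 then dirac m A else normal_prob m s A.

Section processes.
Context {R : realType} (disp : measure_display) (T : measurableType disp).
Context (P : probability T R).

(* Finite-dimensional laws are Gaussian, i.e. every finite linear combination
   of the random variables is a (possibly degenerate) Gaussian variable. *)
Definition gaussian_process (I : Type) (X : I -> {RV P >-> R}) : Prop :=
  forall (n : nat) (t : 'I_n -> I) (a : 'I_n -> R),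
    gaussian_law (pushforward P (fun w : T => \sum_(i < n) a i * X (t i) w)).

Definition centred_process (I : Type) (X : I -> {RV P >-> R}) : Prop :=
  forall t : I, ('E_P[X t] = 0)%E.

Definition continuous_process (I : topologicalType) (X : I -> {RV P >-> R}) :
    Prop :=
  forall w : T, continuous (fun t : I => X t w).

Definition spherical_fBm (d : nat) (H : R) (O : sphere R d)
    (S : sphere R d -> {RV P >-> R}) : Prop :=
  [/\ continuous_process S,
      gaussian_process S,
      centred_process S &
      forall eta zeta : sphere R d,
        'E_P[(S eta : T -> R) \* (S zeta : T -> R)]%E =
        (2^-1 * (geodist eta O `^ (2 * H) + geodist zeta O `^ (2 * H)
                 - geodist eta zeta `^ (2 * H)))%:E].

End processes.

(* Main.v *)
From HB Require Import structures.
Require Import Defs.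
From mathcomp Require Import all_boot all_order all_algebra.
From mathcomp Require Import all_classical all_reals all_analysis.
From mathcomp Require Import measurable_realfun.
From mathcomp Require Import ring lra.
Import Order.TTheory GRing.Theory Num.Theory.
Import numFieldNormedType.Exports.
Local Open Scope classical_set_scope.
Local Open Scope ring_scope.

Set Implicit Arguments.
Unset Strict Implicit.
Unset Printing Implicit Defensive.

(** Write d' for the dimension d - 1 of the sphere and p(eps) for the probability
that the field stays below eps.  The theorem follows from two power bounds:
p(eps) <= C eps^theta for every positive theta < d' / H ([upper_bound]), and
p(eps) >= c eps^tau for every tau > d' / H ([lower_bound]).  Both compare the
field with itself seen from another point: a reflection rho exchanging O and x
preserves the geodesic distance, so the increments S(y) - S(x) have the same
joint law as S(rho(y)) ([increment_law]).  Hence p(eps) is, up to the choice of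
eps, the probability that x is an approximate maximum point of S, for any x.

Upper bound.  Choose n^d' points on the sphere, at mutual distances at
least r = 1 / (n d), and let eps be a small multiple of r^H.  If all increments
from x_i to the other points are below eps, move the field down by a multiple
of the covariance function of a Gaussian variable Z attached to x_i: the shift
costs little in probability and lowers every increment by at least 2 eps, so x_i
becomes the strict maximum of the family ([gaussian_shift],
[test_variable_exists]).
Strict maximum points are unique, so the probabilities of these events for the
different x_i sum to at most 1, and n^d' p(eps) is at most a small power of n
([grid_bound]).  The variable Z is the mean of two increments from x_i to
opposite points at distance r.  That it correlates positively with every
increment ending farther than r from x_i is the geometric heart of the proof;
it uses H <= 1/2 through the subadditivity of t^(2H).

Lower bound.  For kappa < H, chaining along dyadic nets shows that, with
probability at least 1/2, some point of the K-th net has a value within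
A 2^(-kappa K) of the supremum ([chaining], [rough_probability]).  The net has
about 2^(d' K) points, each of which has this property with probability at most
p(2 A 2^(-kappa K)) ([net_sup]); so this p is at least a multiple of 2^(-d' K)
([dyadic_lower_bound]).

Laws of Gaussian vectors enter only through their characteristic functions.
The comparison [probability_all_lt_le] turns equality of characteristic
functions into an inequality between probabilities of orthants, open on one
side and closed on the other; all estimates have enough room in eps for this
difference. *)

(** * Integration against the normal law *)
Section normal_law.
Context {R : realType}.
Local Notation mu := (@lebesgue_measure R).
Implicit Types (m s : R).

(** The Radon-Nikodym derivative of the normal law agrees almost everywhere with
the Gaussian density, since both integrate to the same measure. *)
Lemma ge0_integral_normal m s (f : R -> \bar R) : measurable_fun [set: R] f ->
  (forall x, (0 <= f x)%E) ->
  (\int[normal_prob m s]_x f x = \int[mu]_x (f x * (normal_pdf m s x)%:E))%E.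
Proof.
move=> mf f0.
have dom := @normal_prob_dominates R m s.
rewrite -(Radon_Nikodym_SigmaFinite.change_of_variables dom)//.
apply: ge0_ae_eq_integral => //.
- apply: emeasurable_funM => //; apply: measurable_int.
  exact: Radon_Nikodym_SigmaFinite.f_integrable.
- apply: emeasurable_funM => //.
  by apply/measurable_EFinP; exact: measurable_normal_pdf.
- by move=> x _; rewrite mule_ge0//; exact: Radon_Nikodym_SigmaFinite.f_ge0.
- by move=> x _; rewrite mule_ge0// lee_fin normal_pdf_ge0.
- apply: ae_eqe_mul2l; apply: integral_ae_eq => //.
  + exact: Radon_Nikodym_SigmaFinite.f_integrable.
  + by apply/measurable_EFinP; exact: measurable_normal_pdf.
  + by move=> E _ mE; rewrite -Radon_Nikodym_SigmaFinite.f_integral.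
Qed.

Lemma integrable_normal m s (f : R -> R) : measurable_fun [set: R] f ->
  (normal_prob m s).-integrable setT (EFin \o f) <->
  mu.-integrable setT (fun x => (f x * normal_pdf m s x)%:E).
Proof.
move=> mf.
have e : (\int[normal_prob m s]_x `|(f x)%:E| =
          \int[mu]_x `|(f x * normal_pdf m s x)%:E|)%E.
  rewrite ge0_integral_normal//.
    apply: eq_integral => x _.
    by rewrite EFinM abseM (gee0_abs (x := (normal_pdf m s x)%:E)) ?lee_fin ?normal_pdf_ge0.
  by apply: measurableT_comp => //; exact/measurable_EFinP.
split => /integrableP[_ h]; apply/integrableP; split.
- apply/measurable_EFinP/measurable_funM => //; exact: measurable_normal_pdf.
- by rewrite -e.
- exact/measurable_EFinP.
- by rewrite /= e.
Qed.

Lemma integral_normal m s (f : R -> R) :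
  (normal_prob m s).-integrable setT (EFin \o f) ->
  (\int[normal_prob m s]_x (f x)%:E = \int[mu]_x (f x * normal_pdf m s x)%:E)%E.
Proof.
move=> fi; have mf : measurable_fun [set: R] f by apply/measurable_EFinP; exact: measurable_int fi.
have fi' := (integrable_normal m s mf).1 fi.
rewrite integralE [RHS]integralE.
have mpdf : measurable_fun [set: R] (normal_pdf m s) by exact: measurable_normal_pdf.
congr (_ - _)%E.
  rewrite ge0_integral_normal//; last first.
    by apply: measurable_funepos; exact/measurable_EFinP.
  apply: eq_integral => x _; rewrite !funeposE -!EFin_max -EFinM; congr EFin.
  by rewrite -[in RHS](mul0r (normal_pdf m s x)) -maxr_pMl ?normal_pdf_ge0.
rewrite ge0_integral_normal//; last first.
  by apply: measurable_funeneg; exact/measurable_EFinP.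
apply: eq_integral => x _; rewrite !funenegE -!EFinN -!EFin_max -EFinM; congr EFin.
by rewrite -mulNr -[in RHS](mul0r (normal_pdf m s x)) -maxr_pMl ?normal_pdf_ge0.
Qed.

End normal_law.

(** * Stein's identity and the moments of the normal law *)
Section vanishing_integral.
Context {R : realType}.
Local Notation mu := (@lebesgue_measure R).

Lemma expr_le_fact_expR (k : nat) (u : R) : 0 <= u -> u ^+ k <= k`!%:R * expR u.
Proof.
move=> u0; have -> : u ^+ k = k`!%:R * exp_coeff u k.
  by rewrite /exp_coeff /= mulrC divfK// pnatr_eq0 -lt0n fact_gt0.
apply: ler_wpM2l => //.
have h : series (exp_coeff u) k.+1 <= expR u.
  apply: nondecreasing_cvgn_le; last exact: is_cvg_series_exp_coeff.
  apply: nondecreasing_series => n _ _; exact: exp_coeff_ge0.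
apply: le_trans h; rewrite /series/= big_nat_recr//= lerDr.
by rewrite sumr_ge0// => i _; exact: exp_coeff_ge0.
Qed.

(** On [-n, n] the integral is F(n) - F(-n), which tends to 0 because F decays
like 1 / |x - m|; dominated convergence reaches the whole line. *)
Lemma integral_derivative_eq0 (F h : R -> R) (m C : R) :
  (forall x, is_derive x (1:R) F (h x)) -> continuous h ->
  mu.-integrable setT (EFin \o h) -> (forall x, `|F x| * `|x - m| <= C) ->
  (\int[mu]_x (h x)%:E = 0)%E.
Proof.
move=> dF ch ih FC.
have C0 : 0 <= C by apply: le_trans (FC m); rewrite mulr_ge0.
have mh : measurable_fun [set: R] h by exact: continuous_measurable_fun.
pose I (n : nat) : set R := `[- n%:R, n%:R]%classic.
pose f (n : nat) (x : R) := (h x * \1_(I n) x)%:E.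
have F0 (n : nat) : (\int[mu]_x f n x = (F n%:R - F (- n%:R))%:E)%E.
  rewrite /f; have -> : (\int[mu]_x (h x * \1_(I n) x)%:E =
      \int[mu]_(x in I n) (h x)%:E)%E.
    rewrite [RHS]integral_mkcond; apply: eq_integral => x _.
    rewrite patchE indicE; case: ifPn => _; by rewrite ?mulr1 ?mulr0.
  case: n => [|n].
    rewrite /I oppr0 subrr set_itv1.
    exact: integral_set1.
  rewrite (@continuous_FTC2 _ h F)//.
  - rewrite -subr_gt0 opprK; by rewrite addr_gt0.
  - exact: continuous_subspaceT.
  - have cF x : F x @[x --> x] --> F x.
      apply: differentiable_continuous; apply/derivable1_diffP.
      by have [] := dF x.
    split.
    + by move=> x _; have [] := dF x.
    + exact: cvg_at_right_filter.
    + exact: cvg_at_left_filter.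
  - by move=> x _; rewrite derive1E; have [_ ->] := dF x.
have lim0 : (\int[mu]_x f n x)%E @[n --> \oo] --> 0%E.
  rewrite (_ : (fun n => _) = (fun n : nat => (F n%:R - F (- n%:R))%:E)); last first.
    by apply/funext.
  apply: cvg_EFin; first exact: nearW.
  rewrite (_ : fine \o _ = (fun n : nat => F n%:R - F (- n%:R)))//.
  apply/cvgrPdist_le => e e0.
  have [N [_ NP]] : exists N : nat, True /\ (`|m| + 2 * C / e < N%:R).
    exists (Num.truncn (`|m| + 2 * C / e)).+1; split => //; exact: truncnS_gt.
  near=> n; have nN : N%:R <= n%:R :> R.
    by rewrite ler_nat; near: n; exact: nbhs_infty_ge.
  rewrite sub0r normrN.
  have Bd (x : R) : n%:R <= `|x| -> `|F x| <= e / 2.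
    move=> nx.
    have xm : 2 * C / e <= `|x - m|.
      have := lerB_dist x m; lra.
    have := FC x.
    move: xm; rewrite ler_pdivrMr// => xm Fxm.
    have [z0|z0] := eqVneq C 0.
      have : 0 < `|x - m|.
        have := lerB_dist x m; have : 0 <= 2 * C / e by rewrite divr_ge0 ?mulr_ge0 ?(ltW e0).
        lra.
      move=> xm0; rewrite z0 in Fxm.
      have : `|F x| <= 0 by rewrite -(pmulr_lle0 _ xm0).
      by move=> /le_trans; apply; rewrite divr_ge0 ?ltW.
    have C1 : 0 < C by rewrite lt_def z0.
    have xm0 : 0 < `|x - m|.
      rewrite -(pmulr_lgt0 _ e0); apply: lt_le_trans xm; by rewrite mulr_gt0.
    rewrite -(ler_pM2r xm0); apply: le_trans Fxm _; lra.
  rewrite (le_trans (ler_normB _ _))// (_ : e = e / 2 + e / 2) ?lerD//; last first.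
  - by field.
  - by apply: Bd; rewrite normrN normr_nat.
  - by apply: Bd; rewrite normr_nat.
have := @dominated_convergence _ _ _ mu setT measurableT f (EFin \o h)
  (fun x => `|(h x)%:E|%E).
case.
- move=> n; apply/measurable_EFinP/measurable_funM => //.
  by apply: measurable_indic; exact: measurable_itv.
- exact: (measurable_int _ ih).
- apply: aeW => x _; apply: cvg_near_cst.
  near=> n; rewrite /f /= indicE mem_set ?mulr1//.
  rewrite /I/= in_itv/= -ler_norml.
  have xN : `|x| <= (Num.truncn `|x|).+1%:R by exact/ltW/truncnS_gt.
  by rewrite (le_trans xN)// ler_nat; near: n; exact: nbhs_infty_ge.
- exact: integrable_abse.
- apply: aeW => x n _; rewrite /f abse_EFin lee_fin normrM ler_piMr//.
  rewrite indicE; by case: (_ \in _); rewrite ?normr1 ?normr0.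
by move=> _ _ /cvg_lim h1; move/cvg_lim : lim0 => h2; rewrite -h1// h2.
Unshelve. all: by end_near. Qed.
End vanishing_integral.

Lemma Rintegral_probability_cst d (T : measurableType d) (R : realType)
  (P : probability T R) (r : R) : \int[P]_x r = r.
Proof.
rewrite Rintegral_cst// [X in fine X](_ : _ = 1%E) ?mulr1//.
exact: (probability_setT P).
Qed.

Section gaussian_moments.
Context {R : realType}.
Local Notation mu := (@lebesgue_measure R).
Variables (m s : R).
Hypothesis s0 : 0 < s.

(** One smooth weight, at least 1, that dominates the constants, the
trigonometric functions and the powers of x - m, so that a single growth
condition covers every integrand below. *)
Definition poly_weight (k : nat) (x : R) : R := (1 + (x - m) ^+ 2) ^+ k.

Lemma poly_weight_ge1 k x : 1 <= poly_weight k x.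
Proof. by rewrite /poly_weight exprn_ege1// lerDl sqr_ge0. Qed.

(** Half of the Gaussian exponent absorbs the polynomial, by u^k <= k! e^u; the
other half is the density of variance 2 s^2, which is both integrable and
bounded. *)
Lemma poly_weight_normal_pdf k : exists2 D : R, 0 <= D &
  forall x, poly_weight k x * normal_pdf m s x <= D * normal_pdf m (Num.sqrt 2 * s) x.
Proof.
have t0 : 0 < Num.sqrt 2 * s by rewrite mulr_gt0 ?sqrtr_gt0.
have p0 : 0 < normal_peak (Num.sqrt 2 * s) by rewrite normal_peak_gt0 ?gt_eqF.
exists (normal_peak s * k`!%:R * (4 * s ^+ 2) ^+ k * expR (4 * s ^+ 2)^-1
   / normal_peak (Num.sqrt 2 * s)).
  apply: divr_ge0; last exact: ltW.
  have a0 : 0 <= 4 * s ^+ 2 by rewrite mulr_ge0 ?sqr_ge0.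
  by rewrite mulr_ge0 ?expR_ge0// mulr_ge0 ?exprn_ge0// mulr_ge0 ?normal_peak_ge0.
move=> x; rewrite !normal_pdfE ?gt_eqF// /normal_fun.
set y := x - m; set c := normal_peak s; set c' := normal_peak _.
have c0 : 0 <= c by exact: normal_peak_ge0.
rewrite [leRHS]mulrA divfK ?gt_eqF// -!mulrA mulrCA; apply: ler_wpM2l => //.
have -> : (Num.sqrt 2 * s) ^+ 2 *+ 2 = 4 * s ^+ 2.
  by rewrite exprMn sqr_sqrtr// -mulr_natr; ring.
have a0 : 0 < 4 * s ^+ 2 by rewrite mulr_gt0// exprn_gt0.
have -> : - y ^+ 2 / (s ^+ 2 *+ 2) = - (y ^+ 2 / (4 * s ^+ 2)) - y ^+ 2 / (4 * s ^+ 2).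
  by rewrite -mulr_natr; field; rewrite gt_eqF.
move: a0; set a := 4 * s ^+ 2 => a0.
rewrite mulNr expRD !mulrA; apply: ler_wpM2r; first exact: expR_ge0.
rewrite expRN ler_pdivrMr ?expR_gt0//.
have := @expr_le_fact_expR _ k ((1 + y ^+ 2) / a).
rewrite divr_ge0 ?addr_ge0 ?sqr_ge0 ?(ltW a0)// => /(_ isT).
rewrite exprMn exprVn ler_pdivrMr ?exprn_gt0// mulrDl mul1r expRD.
by rewrite /poly_weight -/y => /le_trans; apply; rewrite le_eqVlt; apply/orP; left; apply/eqP; ring.
Qed.

Lemma integrable_poly_weight k (C : R) (f : R -> R) :
  measurable_fun [set: R] f -> (forall x, `|f x| <= C * poly_weight k x) ->
  (normal_prob m s).-integrable setT (EFin \o f).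
Proof.
move=> mf fC; apply/integrable_normal => //.
have [D D0 HD] := poly_weight_normal_pdf k.
have C0 : 0 <= C.
  have := le_trans (normr_ge0 (f 0)) (fC 0).
  by rewrite pmulr_lge0// (lt_le_trans _ (poly_weight_ge1 _ _)).
have : mu.-integrable setT
   (fun x => ((C * D)%:E * (normal_pdf m (Num.sqrt 2 * s) x)%:E)%E).
  by apply: integrableZl => //; exact: integrable_normal_pdf.
apply: le_integrable => //.
  apply/measurable_EFinP/measurable_funM => //; exact: measurable_normal_pdf.
move=> x _; rewrite -EFinM !abse_EFin lee_fin [leLHS]normrM.
rewrite [leRHS]ger0_norm; last by rewrite mulr_ge0 ?normal_pdf_ge0// mulr_ge0.
rewrite [X in _ * X <= _]ger0_norm ?normal_pdf_ge0//.
apply: (@le_trans _ _ (C * poly_weight k x * normal_pdf m s x)).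
  by apply: ler_wpM2r; [exact: normal_pdf_ge0|exact: fC].
by rewrite -!mulrA; exact: ler_wpM2l.
Qed.

Lemma is_derive_normal_pdf (x : R) :
  is_derive x (1 : R) (normal_pdf m s) (- (x - m) / s ^+ 2 * normal_pdf m s x).
Proof.
rewrite normal_pdfE ?gt_eqF//.
rewrite /normal_fun; set c := normal_peak s.
have Hg : is_derive x (1:R) (fun x : R => - (x - m) ^+ 2 / (s ^+ 2 *+ 2)) (- (x - m) / s ^+ 2).
  apply: is_derive_eq.
  rewrite /GRing.scale/= ?expr1 -mulr_natr.
  by field; rewrite gt_eqF.
have He : is_derive x (1:R) (fun x : R => c * expR (- (x - m) ^+ 2 / (s ^+ 2 *+ 2)))
  (c * (expR (- (x - m) ^+ 2 / (s ^+ 2 *+ 2)) * (- (x - m) / s ^+ 2))).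
  exact: is_deriveZ.
apply: is_derive_eq He _.
by rewrite /=; ring.
Qed.

Lemma poly_weightS k x : poly_weight k.+1 x = (1 + (x - m) ^+ 2) * poly_weight k x.
Proof. by rewrite /poly_weight exprS. Qed.

Lemma norm_center_le (x : R) : `|x - m| <= 1 + (x - m) ^+ 2.
Proof. rewrite -(real_normK (num_real (x - m))); have := normr_ge0 (x - m); nra. Qed.

Lemma poly_weight_center k (C : R) (f : R -> R) :
  (forall x, `|f x| <= C * poly_weight k x) ->
  forall x, `|(x - m) * f x| <= C * poly_weight k.+1 x.
Proof.
move=> fC x; rewrite poly_weightS normrM mulrCA; apply: ler_pM => //.
exact: norm_center_le.
Qed.

Lemma measurable_center : measurable_fun [set: R] (fun x : R => x - m).
Proof. exact: measurable_funB. Qed.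

(** The derivative of f times the density has integral zero, and the density
has logarithmic derivative - (x - m) / s^2. *)
Lemma stein k (C : R) (f f' : R -> R) :
  (forall x : R, is_derive x (1 : R) f (f' x)) -> continuous f' ->
  (forall x, `|f x| <= C * poly_weight k x) ->
  (forall x, `|f' x| <= C * poly_weight k x) ->
  \int[normal_prob m s]_x ((x - m) * f x) = s ^+ 2 * \int[normal_prob m s]_x f' x.
Proof.
move=> df cf' fC f'C.
have cf : continuous f.
  move=> x; apply: differentiable_continuous; apply/derivable1_diffP.
  by have [] := df x.
have mf : measurable_fun [set: R] f by exact: continuous_measurable_fun.
have mf' : measurable_fun [set: R] f' by exact: continuous_measurable_fun.
have mg : measurable_fun [set: R] (fun x => (x - m) * f x).
  by apply: measurable_funM => //; exact: measurable_center.
have ig := integrable_poly_weight mg (poly_weight_center fC).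
have if' := integrable_poly_weight mf' f'C.
have ig1 := (integrable_normal m s mg).1 ig.
have if1 := (integrable_normal m s mf').1 if'.
pose h x := f' x * normal_pdf m s x - s ^- 2 * ((x - m) * f x * normal_pdf m s x).
have s2 : s ^+ 2 != 0 by rewrite gt_eqF// exprn_gt0.
have cpdf : continuous (normal_pdf m s) by apply: continuous_normal_pdf; rewrite gt_eqF.
have [D D0 HD] := poly_weight_normal_pdf k.+1.
have C0 : 0 <= C.
  have := le_trans (normr_ge0 (f 0)) (fC 0).
  by rewrite pmulr_lge0// (lt_le_trans _ (poly_weight_ge1 _ _)).
have ig2 : mu.-integrable setT
    (EFin \o (fun x => s ^- 2 * ((x - m) * f x * normal_pdf m s x))).
  by rewrite (_ : _ \o _ = (fun x => (s ^- 2)%:E * ((x - m) * f x * normal_pdf m s x)%:E)%E)//;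
    exact: integrableZl.
have h0 : (\int[mu]_x (h x)%:E = 0)%E.
  apply: (@integral_derivative_eq0 _ (fun x => f x * normal_pdf m s x) h m
    (C * D * normal_peak (Num.sqrt 2 * s))).
  - move=> x; have dx := df x; have dp := is_derive_normal_pdf x.
    apply: is_derive_eq; rewrite /h /GRing.scale/=; field.
    by rewrite gt_eqF.
  - move=> x; apply: cvgB; first by apply: cvgM; [exact: cf'|exact: cpdf].
    apply: cvgM; first exact: cvg_cst.
    apply: cvgM; last exact: cpdf.
    by apply: cvgM; [apply: cvgB; [exact: cvg_id|exact: cvg_cst]|exact: cf].
  - rewrite (_ : _ \o _ = (fun x => (f' x * normal_pdf m s x)%:E -
      (s ^- 2 * ((x - m) * f x * normal_pdf m s x))%:E)%E)//.
    exact: integrableB.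
  - move=> x; rewrite normrM (ger0_norm (normal_pdf_ge0 m s x)) mulrAC -normrM.
    rewrite [X in `|X|]mulrC.
    apply: (@le_trans _ _ (C * poly_weight k.+1 x * normal_pdf m s x)).
      by rewrite ler_wpM2r ?normal_pdf_ge0// poly_weight_center.
    rewrite -!mulrA ler_wpM2l//; apply: le_trans (HD x) _.
    by rewrite ler_wpM2l// normal_pdf_ub// gt_eqF// mulr_gt0.
move: h0; rewrite /h.
under eq_integral do rewrite EFinB.
rewrite integralB//.
under [X in (_ - X)%E]eq_integral do rewrite EFinM.
rewrite integralZl// -!integral_normal// => /eqP.
have fin1 := integrable_fin_num measurableT ig.
have fin2 := integrable_fin_num measurableT if'.
rewrite /Rintegral; move: fin1 fin2 => /=.
case: (integral _ _ _) => [a| |]// _; case: (integral _ _ _) => [b| |]//= _.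
rewrite -EFinD eqe => /eqP e.
by rewrite (subr0_eq e) mulVKf.
Qed.

Lemma integral_center : \int[normal_prob m s]_x (x - m) = 0.
Proof.
have := @stein 0 1 (cst 1) (cst 0).
under eq_Rintegral do rewrite mulr1.
move=> ->.
- by rewrite (Rintegral_probability_cst (normal_prob m s)) mulr0.
- by move=> x; exact: cst_continuous.
- by move=> x; rewrite normr1 mul1r poly_weight_ge1.
- by move=> x; rewrite normr0 mul1r (le_trans _ (poly_weight_ge1 _ _)).
Qed.

Lemma center_le_poly_weight k x : `|(x - m) ^+ k| <= 1 * poly_weight k x.
Proof. by rewrite mul1r normrX /poly_weight lerXn2r ?nnegrE// ?addr_ge0 ?sqr_ge0// norm_center_le. Qed.

Lemma integrable_center_pow k :
  (normal_prob m s).-integrable setT (EFin \o (fun x => (x - m) ^+ k)).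
Proof.
apply: (integrable_poly_weight _ (@center_le_poly_weight k)).
by apply: measurable_funX; exact: measurable_center.
Qed.

(** Stein's identity for (x - m)^(k + 1). *)
Lemma integral_center_powSS k :
  \int[normal_prob m s]_x (x - m) ^+ k.+2 =
  k.+1%:R * s ^+ 2 * \int[normal_prob m s]_x (x - m) ^+ k.
Proof.
have := @stein k.+1 k.+1%:R (fun x => (x - m) ^+ k.+1) (fun x => k.+1%:R * (x - m) ^+ k).
under eq_Rintegral do rewrite -exprS.
rewrite RintegralZl//; last exact: integrable_center_pow.
rewrite mulrCA mulrA; apply.
- move=> x; have d1 : is_derive x (1 : R) (fun x : R => x - m) 1.
    by apply: is_derive_eq; rewrite subr0.
  have -> : (fun x : R => (x - m) ^+ k.+1) = ((fun x : R => x - m) : R -> R) ^+ k.+1.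
    by apply/funext => z; rewrite exprfctE.
  apply: is_derive_eq (is_deriveX k.+1 d1) _.
  by rewrite /GRing.scale/= mulr1.
- move=> x; apply: cvgM; first exact: cvg_cst.
  apply: (@continuous_comp _ _ _ (fun y : R => y - m) (fun y : R => y ^+ k)); last exact: exprn_continuous.
  by apply: cvgB; [exact: cvg_id|exact: cvg_cst].
- move=> x; apply: le_trans (center_le_poly_weight k.+1 x) _.
  by rewrite ler_wpM2r ?(le_trans _ (poly_weight_ge1 _ _))// ler1n.
- move=> x; rewrite normrM normr_nat ler_wpM2l//.
  rewrite (le_trans (center_le_poly_weight k x))// mul1r /poly_weight.
  by rewrite ler_weXn2l// lerDl sqr_ge0.
Qed.

Lemma integral_center_pow_even k :
  \int[normal_prob m s]_x (x - m) ^+ k.*2 = (\prod_(i < k) (i.*2).+1)%:R * s ^+ k.*2.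
Proof.
elim: k => [|k IH].
  rewrite big_ord0 mul1r; under eq_Rintegral do rewrite expr0.
  by rewrite (Rintegral_probability_cst (normal_prob m s)) expr0.
rewrite doubleS integral_center_powSS IH big_ord_recr/= natrM.
by rewrite !exprS expr0; ring.
Qed.

End gaussian_moments.

(** * Characteristic function of the normal law *)
Section characteristic_function.
Context {R : realType}.
Variables (m s : R).
Hypothesis s0 : 0 < s.

Let y (t b x : R) := t * (x - m) + b.

Let cy t b : continuous (y t b).
Proof.
move=> x; apply: cvgD; last exact: cvg_cst.
by apply: cvgM; [exact: cvg_cst|apply: cvgB; [exact: cvg_id|exact: cvg_cst]].
Qed.

Let mcos t b : measurable_fun [set: R] (fun x => cos (y t b x)).
Proof.
apply: continuous_measurable_fun => x.
by apply: continuous_comp; [exact: cy|exact: continuous_cos].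
Qed.

Let msin t b : measurable_fun [set: R] (fun x => sin (y t b x)).
Proof.
apply: continuous_measurable_fun => x.
by apply: continuous_comp; [exact: cy|exact: continuous_sin].
Qed.

Let icos t b : (normal_prob m s).-integrable setT (EFin \o (fun x => cos (y t b x))).
Proof.
apply: (@integrable_poly_weight _ m s s0 0 1) => // x.
by rewrite mul1r cos_max.
Qed.

Let dyx t b x : is_derive x (1 : R) (y t b) t.
Proof. by apply: is_derive_eq; rewrite /GRing.scale/=; ring. Qed.

Let dyt b x t : is_derive t (1 : R) (fun t => y t b x) (x - m).
Proof. by apply: is_derive_eq; rewrite /GRing.scale/=; ring. Qed.

(** Stein's identity turns the derivative in t of the characteristic function
back into the characteristic function. *)
Let stein_sin t b : \int[normal_prob m s]_x ((x - m) * sin (y t b x)) =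
  s ^+ 2 * (t * \int[normal_prob m s]_x cos (y t b x)).
Proof.
have df x : is_derive x (1 : R) (fun x => sin (y t b x)) (cos (y t b x) * t).
  by have d := dyx t b x; exact: is_derive1_comp.
have cc : continuous (fun x => cos (y t b x) * t).
  move=> x; apply: cvgM; last exact: cvg_cst.
  by apply: continuous_comp; [exact: cy|exact: continuous_cos].
rewrite (stein (k := 0) (C := 1 + `|t|) s0 df cc).
- by congr *%R; rewrite -RintegralZl//; apply: eq_Rintegral => x _; exact: mulrC.
- by move=> x; rewrite /poly_weight expr0 mulr1 (le_trans (sin_max _))// lerDl.
- move=> x; rewrite /poly_weight expr0 mulr1 normrM.
  by rewrite (le_trans (ler_wpM2r _ (cos_max _)))// mul1r lerDr.
Qed.

Let dcos b t : is_derive t (1 : R) (fun t => \int[normal_prob m s]_x cos (y t b x))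
  (- (s ^+ 2 * t) * \int[normal_prob m s]_x cos (y t b x)).
Proof.
pose f (t x : R) := cos (y t b x).
have dft u x : is_derive u (1 : R) (f ^~ x) (- ((x - m) * sin (y u b x))).
  have d := dyt b x u; apply: is_derive_eq (is_derive1_comp _ _) _.
  by rewrite mulNr mulrC.
have p1 u x : partial1of2 f u x = - ((x - m) * sin (y u b x)).
  by rewrite partial1of2E; have [_ ->] := dft u x.
have tI : `]t - 1, t + 1[%classic t by rewrite /= in_itv/= ltrBlDr ltrDl ltr01.
have H1 x : `]t - 1, t + 1[%classic x ->
    (normal_prob m s).-integrable setT (EFin \o f x) by move=> _; exact: icos.
have H2 (x z : R) : `]t - 1, t + 1[%classic x -> [set: R] z -> derivable (f ^~ z) x 1.
  by move=> _ _; have [] := dft x z.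
have iG : (normal_prob m s).-integrable setT (EFin \o (fun x => `|x - m|)).
  by apply: integrable_norm; have := @integrable_center_pow _ m s s0 1.
have H3 (x z : R) : `]t - 1, t + 1[%classic x -> [set: R] z ->
   `|partial1of2 f x z| <= `|z - m|.
  by move=> _ _; rewrite p1 normrN normrM ler_piMr// sin_max.
have D1 := derivable_under_integral measurableT tI H1 H2 (fun=> normr_ge0 _) iG H3.
have D2 := differentiation_under_integral measurableT tI H1 H2 (fun=> normr_ge0 _) iG H3.
apply: DeriveDef => //.
rewrite -derive1E D2.
under eq_Rintegral do rewrite p1 -mulN1r.
rewrite RintegralZl//.
  by rewrite stein_sin mulN1r mulNr mulrA.
apply: (@integrable_poly_weight _ m s s0 1 1).
  by apply: measurable_funM => //; exact: measurable_center.
apply: poly_weight_center => x; by rewrite mul1r /poly_weight expr0 sin_max.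
Qed.

(** As a function of t, the left-hand side G solves G' = - s^2 t G, so
G(t) exp((t s)^2 / 2) is constant.  The phase b carries the real and the
imaginary parts of the characteristic function at once. *)
Lemma normal_characteristic_function t b :
  \int[normal_prob m s]_x cos (t * (x - m) + b) = expR (- (t * s) ^+ 2 / 2) * cos b.
Proof.
pose G t := \int[normal_prob m s]_x cos (y t b x).
have dG u : is_derive u (1 : R) G (- (s ^+ 2 * u) * G u) by exact: dcos.
pose K u := G u * expR ((u * s) ^+ 2 / 2).
have dE (u : R) : is_derive u (1 : R) (fun u : R => expR ((u * s) ^+ 2 / 2))
    (expR ((u * s) ^+ 2 / 2) * (s ^+ 2 * u)).
  apply: is_derive1_comp.
  by apply: is_derive_eq; rewrite /GRing.scale/= ?expr1; field.
have dK u : is_derive u (1 : R) K 0.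
  have h1 := dG u; have h2 := dE u.
  by apply: is_derive_eq; rewrite /GRing.scale/=; ring.
have : K t = K 0 by apply: is_derive_0_is_cst.
rewrite /K mul0r expr0n/= mul0r expR0 mulr1 => e.
have G0 : G 0 = cos b.
  rewrite /G /y; under eq_Rintegral do rewrite mul0r add0r.
  by rewrite (Rintegral_probability_cst (normal_prob m s)).
rewrite -/(G t) mulNr expRN -G0 -e; field.
by rewrite gt_eqF// expR_gt0.
Qed.

End characteristic_function.

(** * Translation of the normal law *)
Section normal_shift.
Context {R : realType}.
Local Notation mu := (@lebesgue_measure R).

Lemma normal_pdf1E (m x : R) :
  normal_pdf m 1 x = normal_pdf 0 1 x * expR (m * x - m ^+ 2 / 2).
Proof.
rewrite !normal_pdfE ?oner_neq0// /normal_fun -mulrA -expRD; congr (_ * expR _).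
by field.
Qed.

(** Let y be the ratio of the densities of N(-1, 1) and N(0, 1).  Where y <= K
the first term is enough.  Elsewhere y <= y^(m + 1) / K^m, and y^(m + 1) is,
up to a constant factor, the ratio of the densities of N(-(m + 1), 1) and
N(0, 1). *)
Lemma normal_pdf_shift_le (m : nat) (K : R) (x : R) : 0 < K ->
  normal_pdf (-1) 1 x <= K * normal_pdf 0 1 x
   + expR ((m.+1%:R ^+ 2 - m.+1%:R) / 2) * K ^- m * normal_pdf (- m.+1%:R) 1 x.
Proof.
move=> K0; rewrite normal_pdf1E (normal_pdf1E (- _)).
set p := normal_pdf 0 1 x; have p0 : 0 <= p by exact: normal_pdf_ge0.
set y := expR (-1 * x - (-1) ^+ 2 / 2).
have y0 : 0 < y by exact: expR_gt0.
have yE : y ^+ m.+1 = expR ((m.+1%:R ^+ 2 - m.+1%:R) / 2) *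
    expR (- m.+1%:R * x - (- m.+1%:R) ^+ 2 / 2).
  by rewrite /y -expRM_natl -expRD; congr expR; field.
rewrite (_ : _ * K ^- m * _ = p * (y ^+ m.+1 / K ^+ m)); last by rewrite yE; ring.
rewrite [K * p]mulrC -mulrDr ler_wpM2l//.
have [yK|Ky] := leP y K; first by rewrite (le_trans yK)// lerDl divr_ge0// ?exprn_ge0 ?ltW.
apply: (@le_trans _ _ (y ^+ m.+1 / K ^+ m)); last by rewrite lerDr ltW.
rewrite ler_pdivlMr ?exprn_gt0// exprS ler_pM2l//.
by rewrite lerXn2r ?nnegrE ?ltW.
Qed.

(** The price of a translation by one standard deviation: a factor K and an
additive error.  If K is a small power of some large number, a large m makes the
error smaller than any prescribed power of that number. *)
Lemma normal_prob_shift_le (m : nat) (K : R) (B : set (measurableTypeR R)) :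
  0 < K -> measurable B ->
  (normal_prob (-1) 1 B <= K%:E * normal_prob 0 1 B +
    (expR ((m.+1%:R ^+ 2 - m.+1%:R) / 2) * K ^- m)%:E)%E.
Proof.
move=> K0 mB; set c := _ * K ^- m.
have c0 : 0 <= c by rewrite mulr_ge0 ?expR_ge0// invr_ge0 exprn_ge0// ltW.
have mp (a : R) : measurable_fun B (fun x => (normal_pdf a 1 x)%:E).
  by apply/measurable_EFinP; apply: measurable_funTS; exact: measurable_normal_pdf.
have pge0 (a : R) x : B x -> (0 <= (normal_pdf a 1 x)%:E)%E.
  by move=> _; rewrite lee_fin normal_pdf_ge0.
apply: (@le_trans _ _ (K%:E * normal_prob 0 1 B + c%:E * normal_prob (- m.+1%:R) 1 B)%E); last first.
  apply: leeD => //; rewrite -[leRHS]mule1 lee_wpmul2l ?lee_fin//.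
  exact: (@probability_le1 _ _ _ (normal_prob (- m.+1%:R) 1)).
rewrite /normal_prob -!ge0_integralZl ?lee_fin ?(ltW K0)//.
rewrite -ge0_integralD//; first last.
- by apply: measurable_funeM.
- by move=> x Bx; rewrite mule_ge0// ?lee_fin// normal_pdf_ge0.
- by apply: measurable_funeM.
- by move=> x Bx; rewrite mule_ge0 ?lee_fin ?(ltW K0)// normal_pdf_ge0.
apply: ge0_le_integral => //; try exact: pge0.
- by apply: emeasurable_funD; apply: measurable_funeM.
- by move=> x _; rewrite -!EFinM -EFinD lee_fin normal_pdf_shift_le.
- exact: pge0.
- exact: pge0.
Qed.

End normal_shift.

(** * Trigonometric polynomials and approximation of the sign *)
Section trigonometric_polynomials.
Context {R : realType} {J : finType}.
Implicit Types (f g : (J -> R) -> R).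

(** The real functions whose integral is determined by the characteristic
function; an algebra, by the product formula for cosines. *)
Inductive trig_poly : ((J -> R) -> R) -> Prop :=
| trig_poly_cos (a : J -> R) (b : R) :
    trig_poly (fun x => cos (\sum_j a j * x j + b))
| trig_poly_lin (c : R) f g : trig_poly f -> trig_poly g ->
    trig_poly (fun x => c * f x + g x).

Lemma trig_poly_ext f g : f =1 g -> trig_poly f -> trig_poly g.
Proof. by move=> /funext ->. Qed.

Lemma trig_poly_cst c : trig_poly (fun=> c).
Proof.
have t1 : trig_poly (fun=> 1).
  apply: trig_poly_ext (trig_poly_cos (fun=> 0) 0) => x.
  by rewrite big1 ?addr0 ?cos0// => j _; rewrite mul0r.
have t0 : trig_poly (fun=> 0).
  by apply: trig_poly_ext (trig_poly_lin (-1) t1 t1) => x; ring.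
by apply: trig_poly_ext (trig_poly_lin c t1 t0) => x; ring.
Qed.

Lemma trig_polyZ c f : trig_poly f -> trig_poly (fun x => c * f x).
Proof.
move=> tf; apply: trig_poly_ext (trig_poly_lin c tf (trig_poly_cst 0)) => x.
by rewrite addr0.
Qed.

Lemma trig_polyD f g : trig_poly f -> trig_poly g -> trig_poly (fun x => f x + g x).
Proof.
by move=> tf tg; apply: trig_poly_ext (trig_poly_lin 1 tf tg) => x; rewrite mul1r.
Qed.

Lemma trig_polyM f g : trig_poly f -> trig_poly g -> trig_poly (fun x => f x * g x).
Proof.
elim=> [a b|c f1 f2 _ IH1 _ IH2] tg.
  elim: tg => [a' b'|c g1 g2 _ IH1 _ IH2].
    have := trig_polyZ 2^-1 (trig_polyD
      (trig_poly_cos (fun j => a j + a' j) (b + b'))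
      (trig_poly_cos (fun j => a j - a' j) (b - b'))).
    apply: trig_poly_ext => x.
    rewrite (eq_bigr (fun j => a j * x j + a' j * x j)); last by move=> j _; ring.
    rewrite [in X in cos X + cos _]big_split/=.
    rewrite [in X in _ + cos X](eq_bigr (fun j => a j * x j - a' j * x j)); last by move=> j _; ring.
    rewrite sumrB; set A := \sum_j a j * _; set B := \sum_j a' j * _.
    rewrite (_ : A + B + _ = (A + b) + (B + b')); last by ring.
    rewrite (_ : A - B + _ = (A + b) - (B + b')); last by ring.
    by rewrite cosD cosB; field.
  by apply: trig_poly_ext (trig_poly_lin c IH1 IH2) => x; ring.
by apply: trig_poly_ext (trig_poly_lin c (IH1 tg) (IH2 tg)) => x; ring.
Qed.

Lemma trig_poly_prod (s : seq J) (F : J -> (J -> R) -> R) :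
  (forall j, trig_poly (F j)) -> trig_poly (fun x => \prod_(j <- s) F j x).
Proof.
move=> tF; elim: s => [|j s IH].
  by apply: trig_poly_ext (trig_poly_cst 1) => x; rewrite big_nil.
by apply: trig_poly_ext (trig_polyM (tF j) IH) => x; rewrite big_cons.
Qed.

Lemma trig_poly_sin (j : J) (a b : R) : trig_poly (fun x => sin (a * x j + b)).
Proof.
apply: trig_poly_ext (trig_poly_cos (fun i => if i == j then a else 0) (b - pi / 2)) => x.
rewrite (bigD1 j)//= eqxx big1 ?addr0; last by move=> i /negPf ->; rewrite mul0r.
by rewrite addrA cosBpihalf.
Qed.

End trigonometric_polynomials.

Section sign_approximation.
Context {R : realType}.

(** An odd polynomial that maps [-1, 1] to itself, fixes 0 and attracts the rest
of the interval to 1 and -1: its iterates are polynomials converging to the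
sign. *)
Definition sign_step (y : R) : R := (3 * y - y ^+ 3) / 2.

Lemma sign_stepN y : sign_step (- y) = - sign_step y.
Proof. by rewrite /sign_step; field. Qed.

Lemma iter_sign_stepN n y : iter n sign_step (- y) = - iter n sign_step y.
Proof. by elim: n => //= n ->; rewrite sign_stepN. Qed.

Lemma sign_step_ge (y z : R) : 0 <= z -> z <= y -> y <= 1 ->
  z <= sign_step y <= 1 /\ 1 - sign_step y <= (1 - y) * (1 - z / 2).
Proof.
move=> z0 zy y1; have y0 : 0 <= y by lra.
have e1 : sign_step y - y = y * ((1 - y) * (1 + y)) / 2 by rewrite /sign_step; field.
have e2 : 1 - sign_step y = (1 - y) ^+ 2 * (2 + y) / 2 by rewrite /sign_step; field.
have h1 : 0 <= y * ((1 - y) * (1 + y)) by rewrite !mulr_ge0//; lra.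
have h2 : 0 <= (1 - y) ^+ 2 * (2 + y) by rewrite !mulr_ge0 ?sqr_ge0//; lra.
split; first by apply/andP; split; lra.
rewrite -subr_ge0 e2.
rewrite (_ : _ - _ = (1 - y) * ((y - z) + y ^+ 2) / 2); last by field.
apply: divr_ge0 => //; apply: mulr_ge0; first by lra.
by apply: addr_ge0; [lra|exact: sqr_ge0].
Qed.

Lemma iter_sign_step_ge n y : 0 <= y <= 1 ->
  y <= iter n sign_step y <= 1 /\ 1 - iter n sign_step y <= (1 - y / 2) ^+ n.
Proof.
move=> /andP[y0 y1]; elim: n => /= [|n [/andP[IH1 IH2] IH3]].
  by rewrite lexx y1 expr0; split => //; lra.
have [h1 h2] := sign_step_ge y0 IH1 IH2; split => //.
rewrite exprSr (le_trans h2)// ler_wpM2r//; lra.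
Qed.

Lemma iter_sign_step_le1 n y : `|y| <= 1 -> `|iter n sign_step y| <= 1.
Proof.
move=> y1; have [y0|y0] := leP 0 y.
  have [] := @iter_sign_step_ge n y; first by rewrite y0 -(ger0_norm y0).
  by move=> /andP[h1 h2] _; rewrite ger0_norm// (le_trans y0).
rewrite -[y]opprK iter_sign_stepN normrN.
have Ny : 0 <= - y by lra.
have [] := @iter_sign_step_ge n (- y); first by rewrite Ny -(ger0_norm Ny) normrN.
by move=> /andP[h1 h2] _; rewrite ger0_norm// (le_trans Ny).
Qed.

Lemma cvg_iter_sign_step y : `|y| <= 1 -> iter n sign_step y @[n --> \oo] --> Num.sg y.
Proof.
wlog y0 : y / 0 <= y.
  move=> H; have [/H//|y0 y1] := leP 0 y.
  have := H (- y); rewrite oppr_ge0 normrN (ltW y0) => /(_ isT y1).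
  rewrite sgrN => /cvgN; rewrite opprK (_ : - _ = (fun n => iter n sign_step y))//.
  by apply/funext => n; rewrite opprfctE iter_sign_stepN opprK.
rewrite ger0_norm// => y1; move: y0; rewrite le_eqVlt => /predU1P[<-|y0].
  rewrite sgr0 (_ : (fun n => _) = cst 0); first exact: cvg_cst.
  by apply/funext => n/=; elim: n => //= n ->; rewrite /sign_step; ring.
rewrite gtr0_sg//.
have h n := @iter_sign_step_ge n y; rewrite (ltW y0) y1 in h.
apply: (@squeeze_cvgr _ _ _ _ (fun n => 1 - (1 - y / 2) ^+ n) (cst 1)).
- apply: nearW => n; have [/andP[_ h1] h2] := h n isT.
  by rewrite h1 andbT; lra.
- rewrite -[X in _ --> X]subr0; apply: cvgB; first exact: cvg_cst.
  by apply: cvg_expr; rewrite ger0_norm; lra.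
- exact: cvg_cst.
Qed.

(** Composing with sin(x / L) makes the polynomial approximations of the sign
into trigonometric polynomials, without loss in the limit of large L. *)
Lemma sgr_sin (x L : R) : `|x| < L * pi -> 0 < L -> Num.sg (sin (L^-1 * x)) = Num.sg x.
Proof.
move=> xL L0; have [x0|x0|->] := ltgtP x 0; last by rewrite mulr0 sin0.
  rewrite (ltr0_sg x0) -[x]opprK mulrN sinN sgrN gtr0_sg//.
  apply: sin_gt0_pi; rewrite mulr_gt0 ?invr_gt0 ?oppr_gt0//=.
  by rewrite mulrC ltr_pdivrMr// mulrC -ltr0_norm.
rewrite (gtr0_sg x0) gtr0_sg//.
apply: sin_gt0_pi; rewrite mulr_gt0 ?invr_gt0//=.
by rewrite mulrC ltr_pdivrMr// mulrC -(gtr0_norm x0).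
Qed.

End sign_approximation.

(** * Characteristic functions determine probabilities of orthants *)
Lemma probability_integral_indic d (T : measurableType d) (R : realType)
  (P : probability T R) (A : set T) :
  measurable A -> (P A = \int[P]_w (\1_A w)%:E)%E.
Proof. by move=> mA; rewrite integral_indic// setIT. Qed.

Lemma bounded_integrable d (T : measurableType d) (R : realType)
  (P : probability T R) (f : T -> R) (M : R) :
  measurable_fun [set: T] f -> (forall x, `|f x| <= M) -> P.-integrable setT (EFin \o f).
Proof.
move=> mf fM; apply: (@le_integrable _ _ _ P setT _ _ (EFin \o cst M)) => //.
- exact/measurable_EFinP.
- by move=> x _; rewrite /= lee_fin (le_trans (fM x))// ler_norm.
- exact: finite_measure_integrable_cst.
Qed.

Section uniqueness.
Context {R : realType} {J : finType}.
Context d1 (T1 : measurableType d1) (P1 : probability T1 R).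
Context d2 (T2 : measurableType d2) (P2 : probability T2 R).
Variables (U : J -> T1 -> R) (V : J -> T2 -> R).
Hypothesis mU : forall j, measurable_fun [set: T1] (U j).
Hypothesis mV : forall j, measurable_fun [set: T2] (V j).

Let same_law (f : (J -> R) -> R) :=
  [/\ measurable_fun [set: T1] (fun w => f (U^~ w)),
      measurable_fun [set: T2] (fun w => f (V^~ w)) &
      (\int[P1]_w (f (U^~ w))%:E = \int[P2]_w (f (V^~ w))%:E)%E].

(** Bounded pointwise limits preserve equality of integrals; they are used
twice, in the degree of the approximation of the sign and in its period. *)
Let same_law_lim (f_ : nat -> (J -> R) -> R) (f : (J -> R) -> R) :
  (forall n, same_law (f_ n)) -> (forall n x, `|f_ n x| <= 1) ->
  (forall x, f_ n x @[n --> \oo] --> f x) -> same_law f.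
Proof.
move=> sf f1 cf.
have lim d (T : measurableType d) (P : probability T R) (W : J -> T -> R) :
    (forall n, measurable_fun [set: T] (fun w => f_ n (W^~ w))) ->
    measurable_fun [set: T] (fun w => f (W^~ w)) /\
    (\int[P]_w (f_ n (W^~ w))%:E)%E @[n --> \oo] --> (\int[P]_w (f (W^~ w))%:E)%E.
  move=> mf.
  have mlim : measurable_fun [set: T] (fun w => f (W^~ w)).
    by apply: (measurable_fun_cvg mf) => w _; exact: cf.
  split => //.
  have [] := @dominated_convergence _ _ _ P setT measurableT
    (fun n w => (f_ n (W^~ w))%:E) (fun w => (f (W^~ w))%:E) (EFin \o cst 1).
  - by move=> n; exact/measurable_EFinP.
  - exact/measurable_EFinP.
  - by apply: aeW => w _; apply: cvg_EFin; [exact: nearW|exact: cf].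
  - exact: finite_measure_integrable_cst.
  - by apply: aeW => w n _; rewrite lee_fin f1.
  - by [].
have [m1 l1] := lim _ _ P1 U (fun n => let: And3 a _ _ := sf n in a).
have [m2 l2] := lim _ _ P2 V (fun n => let: And3 _ a _ := sf n in a).
split => //.
apply/esym; move/cvg_lim : l1 => <- //; apply/esym; apply/cvg_lim => //.
rewrite (_ : (fun n => _) = (fun n => (\int[P2]_w (f_ n (V^~ w))%:E)%E))//.
by apply/funext => n; have [] := sf n.
Qed.

Hypothesis cf_eq : forall (a : J -> R) (b : R),
  \int[P1]_w cos (\sum_j a j * U j w + b) = \int[P2]_w cos (\sum_j a j * V j w + b).

Let trig_poly_same_law f : trig_poly f -> same_law f.
Proof.
suff H : trig_poly f -> same_law f /\ exists M : R, forall x, `|f x| <= M by move=> /H [].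
have mcos d (T : measurableType d) (W : J -> T -> R) (a : J -> R) (b : R) :
    (forall j, measurable_fun [set: T] (W j)) ->
    measurable_fun [set: T] (fun w => cos (\sum_j a j * W j w + b)).
  move=> mW; apply: measurableT_comp.
    by apply: continuous_measurable_fun; exact: continuous_cos.
  apply: measurable_funD => //; apply: measurable_sum => j.
  exact: measurable_funM.
have bint d (T : measurableType d) (P : probability T R) (h : T -> R) :
    P.-integrable setT (EFin \o h) -> ((\int[P]_w h w)%:E = \int[P]_w (h w)%:E)%E.
  by move=> fi; rewrite /Rintegral fineK//; exact: integrable_fin_num.
elim => [a b|c {}f g tf [[mf1 mf2 ef] [Mf fM]] tg [[mg1 mg2 eg] [Mg gM]]].
  have cM x : `|cos (\sum_j a j * x j + b)| <= 1 by exact: cos_max.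
  split; last by exists 1.
  split; [exact: mcos|exact: mcos|].
  rewrite -!bint ?cf_eq//.
  - by apply: (@bounded_integrable _ _ _ _ _ 1); [exact: mcos|].
  - by apply: (@bounded_integrable _ _ _ _ _ 1); [exact: mcos|].
split; last first.
  exists (`|c| * Mf + Mg) => x; apply: le_trans (ler_normD _ _) _.
  by rewrite lerD// normrM ler_wpM2l.
have H d (T : measurableType d) (P : probability T R) (W : J -> T -> R) :
    measurable_fun [set: T] (fun w => f (W^~ w)) ->
    measurable_fun [set: T] (fun w => g (W^~ w)) ->
    (\int[P]_w (c * f (W^~ w) + g (W^~ w))%:E =
     c%:E * \int[P]_w (f (W^~ w))%:E + \int[P]_w (g (W^~ w))%:E)%E.
  move=> mf mg.
  have if_ : P.-integrable setT (EFin \o (fun w => f (W^~ w))).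
    by apply: (@bounded_integrable _ _ _ _ _ Mf).
  have ig_ : P.-integrable setT (EFin \o (fun w => g (W^~ w))).
    by apply: (@bounded_integrable _ _ _ _ _ Mg).
  under eq_integral do rewrite EFinD EFinM.
  by rewrite integralD ?integralZl//; exact: integrableZl.
split.
- by apply: measurable_funD => //; exact: measurable_funM.
- by apply: measurable_funD => //; exact: measurable_funM.
- by rewrite !H// ef eg.
Qed.

Lemma trig_poly_iter_sign_step n (f : (J -> R) -> R) :
  trig_poly f -> trig_poly (fun x => iter n sign_step (f x)).
Proof.
move=> tf; elim: n => //= n IH.
have := trig_poly_lin (3 / 2) IH (trig_polyZ (- 2^-1) (trig_polyM IH (trig_polyM IH IH))).
by apply: trig_poly_ext => x; rewrite /sign_step; field.
Qed.

Let step (y : R) : R := (1 - y) / 2.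

Let step_norm y : `|y| <= 1 -> 0 <= step y <= 1.
Proof. by rewrite /step ler_norml => /andP[? ?]; apply/andP; split; lra. Qed.

Let prod_norm (F : J -> R) : (forall j, `|F j| <= 1) -> `|\prod_j step (F j)| <= 1.
Proof.
move=> F1; rewrite ger0_norm; last by apply: prodr_ge0 => j _; have /andP[] := step_norm (F1 j).
by apply: prodr_ile1 => j _; exact: step_norm.
Qed.

Let cvg_prod (F : nat -> J -> R) (G : J -> R) : (forall j, F n j @[n --> \oo] --> G j) ->
  (\prod_j step (F n j)) @[n --> \oo] --> \prod_j step (G j).
Proof.
move=> FG; elim: (index_enum J) => [|j s IH].
  rewrite big_nil (_ : (fun n => _) = cst 1); first exact: cvg_cst.
  by apply/funext => n; rewrite big_nil.
rewrite big_cons (_ : (fun n => _) =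
  (fun n => step (F n j) * \prod_(i <- s) step (F n i))); last first.
  by apply/funext => n; rewrite big_cons.
apply: cvgM => //; apply: cvgM; last exact: cvg_cst.
by apply: cvgB; [exact: cvg_cst|exact: FG].
Qed.

Variable c : J -> R.

Let g (L n : nat) (x : J -> R) :=
  \prod_j step (iter n sign_step (sin (L.+1%:R^-1 * (x j - c j)))).

Let same_law_sgn :
  same_law (fun x => \prod_j step (Num.sg (x j - c j))).
Proof.
apply: (@same_law_lim (fun L x =>
    \prod_j step (Num.sg (sin (L.+1%:R^-1 * (x j - c j)))))).
- move=> L; apply: (@same_law_lim (g L)).
  + move=> n; apply: trig_poly_same_law; apply: trig_poly_prod => j.
    apply: trig_poly_ext (trig_poly_lin (- 2^-1)
      (trig_poly_iter_sign_step n (trig_poly_sin j L.+1%:R^-1 (- L.+1%:R^-1 * c j)))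
      (trig_poly_cst 2^-1)) => x.
    rewrite /step mulrBr [- L.+1%:R^-1 * _]mulNr; set y := iter _ _ _; by field.
  + by move=> n x; apply: prod_norm => j; exact/iter_sign_step_le1/sin_max.
  + by move=> x; apply: cvg_prod => j; exact/cvg_iter_sign_step/sin_max.
- by move=> L x; apply: prod_norm => j; rewrite normr_sg lern1 leq_b1.
- move=> x; apply: cvg_prod => j; apply: cvg_near_cst; near=> L.
  apply: sgr_sin => //.
  apply: (@lt_le_trans _ _ L%:R).
    near: L; exists (Num.truncn `|x j - c j|).+1 => // L /= h.
    by rewrite (lt_le_trans (truncnS_gt _))// ler_nat.
  rewrite (@le_trans _ _ L.+1%:R)// ?ler_nat// ler_peMr//.
  by rewrite (le_trans _ (pi_ge2 R))// ler1n.
Unshelve. all: by end_near. Qed.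

Lemma measurable_all_lt d (T : measurableType d) (W : J -> T -> R) :
  (forall j, measurable_fun [set: T] (W j)) ->
  measurable [set w | forall j, W j w < c j].
Proof.
move=> mW; rewrite (_ : mkset _ = \bigcap_(j in [set: J]) [set w | W j w < c j]).
  apply: fin_bigcap_measurable => // j _.
  by rewrite -[mkset _]setTI; exact: measurable_fun_ltr.
by apply/seteqP; split => w /= h j; [move=> _; exact: h|exact: h].
Qed.

Lemma measurable_all_le d (T : measurableType d) (W : J -> T -> R) :
  (forall j, measurable_fun [set: T] (W j)) ->
  measurable [set w | forall j, W j w <= c j].
Proof.
move=> mW; rewrite (_ : mkset _ = \bigcap_(j in [set: J]) [set w | W j w <= c j]).
  apply: fin_bigcap_measurable => // j _.
  by rewrite -[mkset _]setTI; exact: measurable_fun_ler.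
by apply/seteqP; split => w /= h j; [move=> _; exact: h|exact: h].
Qed.

(** The product over j of (1 - sgn(x_j - c_j)) / 2 is a limit of trigonometric
polynomials, so U and V give it the same expectation.  It lies between the
indicators of the open and of the closed orthant, a factor being 1/2 where
x_j = c_j; this is why one inequality is strict and the other is not. *)
Lemma probability_all_lt_le :
  (P1 [set w | forall j, U j w < c j]%R <= P2 [set w | forall j, V j w <= c j]%R)%E.
Proof.
have [m1 m2 e] := same_law_sgn.
have s01 (y : R) : 0 <= step (Num.sg y) <= 1.
  by apply: step_norm; rewrite normr_sg lern1 leq_b1.
have n01 (x : J -> R) : 0 <= \prod_j step (Num.sg (x j - c j)) <= 1.
  rewrite prodr_ge0/=; last by move=> j _; case/andP: (s01 (x j - c j)).
  by apply: prodr_ile1 => j _; exact: s01.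
have mA := measurable_all_lt mU.
have mB := measurable_all_le mV.
rewrite (probability_integral_indic P1)// (probability_integral_indic P2)//.
apply: (@le_trans _ _ (\int[P1]_w (\prod_j step (Num.sg (U j w - c j)))%:E)%E).
  apply: ge0_le_integral => //.
  - by apply/measurable_EFinP; exact: measurable_indic.
  - exact/measurable_EFinP.
  - move=> w _; rewrite lee_fin indicE; case: (boolP (w \in _)) => [|_]; last by case/andP: (n01 (U^~ w)).
    rewrite inE/= => h; rewrite big1// => j _.
    by rewrite ltr0_sg ?subr_lt0//; rewrite /step; lra.
rewrite e; apply: ge0_le_integral => //.
- by move=> w _; rewrite lee_fin; case/andP: (n01 (V^~ w)).
- exact/measurable_EFinP.
- by apply/measurable_EFinP; exact: measurable_indic.
- move=> w _; rewrite lee_fin indicE; case: (boolP (w \in _)) => [_|]; first by case/andP: (n01 (V^~ w)).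
  rewrite notin_setE/= => /existsNP[j /negP]; rewrite -ltNge => h.
  by rewrite (bigD1 j)//= gtr0_sg ?subr_gt0// /step subrr mul0r mul0r.
Qed.

End uniqueness.

(** * Linear span of a centred Gaussian process *)
Section gaussian_law_facts.
Context {R : realType} d (T : measurableType d) (P : probability T R).

Lemma integral_law (nu : {measure set (measurableTypeR R) -> \bar R}) (A : T -> R) (g : R -> R) :
  measurable_fun [set: T] A ->
  (forall B : set R, measurable B -> pushforward P A B = nu B) ->
  measurable_fun [set: R] g -> nu.-integrable setT (EFin \o g) ->
  P.-integrable setT (EFin \o (g \o A)) /\
  \int[P]_w g (A w) = \int[nu]_x g x.
Proof.
move=> mA lawA mg ig.
have mA' : measurable_fun [set: T] (A : T -> measurableTypeR R) by exact: mA.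
have iP : P.-integrable setT (EFin \o (g \o A)).
  apply/integrableP; split.
    by apply/measurable_EFinP; exact: measurableT_comp.
  have := @ge0_integral_pushforward _ _ _ _ R (A : T -> measurableTypeR R) mA' P setT (fun x => `|(g x)%:E|%E) measurableT.
  rewrite preimage_setT => /= <- //; last first.
    by apply/measurable_EFinP; exact: measurableT_comp.
  rewrite (eq_measure_integral nu); last by move=> B mB _; exact: lawA.
  by move/integrableP : ig => [].
split => //; rewrite /Rintegral; congr fine.
have := @integral_pushforward _ _ _ _ R (A : T -> measurableTypeR R) mA' P setT (EFin \o g).
rewrite preimage_setT => /= <- //; last exact/measurable_EFinP.
by apply: eq_measure_integral => B mB _; exact: lawA.
Qed.

(** The degenerate law, a Dirac mass, satisfies the same formulas with s = 0, so
that no case distinction survives this lemma. *)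
Lemma centred_gaussian_law (A : T -> R) : measurable_fun [set: T] A ->
  gaussian_law (pushforward P A) -> \int[P]_w A w = 0 ->
  exists s : R, 0 <= s /\
  [/\ (forall k, P.-integrable setT (EFin \o (fun w => A w ^+ k))),
      (forall k, \int[P]_w A w ^+ k.*2 = (\prod_(i < k) (i.*2).+1)%:R * s ^+ k.*2) &
      (forall b, \int[P]_w cos (A w + b) = expR (- s ^+ 2 / 2) * cos b)].
Proof.
move=> mA [m [s [s0 law]]] EA; exists s; split => //.
have mX k : measurable_fun [set: R] (fun x : R => x ^+ k) by exact: measurable_funX.
have mcos b : measurable_fun [set: R] (fun x : R => cos (x + b)).
  apply: measurableT_comp; last exact: measurable_funD.
  by apply: continuous_measurable_fun; exact: continuous_cos.
have [z|nz] := eqVneq s 0.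
  have lawD (B : set R) : measurable B -> pushforward P A B = dirac (m : measurableTypeR R) B.
    by move=> mB; rewrite law// z eqxx.
  have D (g : R -> R) : measurable_fun [set: R] g ->
      P.-integrable setT (EFin \o (g \o A)) /\ \int[P]_w g (A w) = g m.
    move=> mg; have [] := @integral_law (dirac (m : measurableTypeR R)) A g mA lawD mg.
      apply/integrableP; split; first exact/measurable_EFinP.
      rewrite integral_dirac//=; last by apply/measurable_EFinP; exact: measurableT_comp.
      by rewrite diracT mul1e ltry.
    move=> ? ->; split => //; rewrite /Rintegral integral_dirac//; last exact/measurable_EFinP.
    by rewrite diracT mul1e.
  have m0 : m = 0 by rewrite -EA; have [_ ->] := D _ (mX 1%N).
  split => [k|k|b].
  - by have [] := D _ (mX k).
  - have [_ ->] := D _ (mX k.*2); rewrite m0 z; case: k => [|k]; last by rewrite doubleS !expr0n/= mulr0.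
    by rewrite big_ord0 mul1r.
  - by have [_ ->] := D _ (mcos b); rewrite m0 z add0r expr0n oppr0 mul0r expR0 mul1r.
have sp : 0 < s by rewrite lt_def nz.
have lawN (B : set R) : measurable B -> pushforward P A B = normal_prob m s B.
  by move=> mB; rewrite law// (negPf nz).
have H g := @integral_law (normal_prob m s) A g mA lawN.
have m0 : m = 0.
  have i1 : (normal_prob m s).-integrable setT (EFin \o (fun x : R => x - m)).
    by have := integrable_center_pow m sp 1.
  have mc : measurable_fun [set: R] (fun x : R => x - m) by exact: measurable_center.
  have [iA] := H _ mc i1; rewrite integral_center// => e.
  have : P.-integrable setT (EFin \o A).
    rewrite (_ : A = (fun w => (A w - m) + m)); last by apply/funext => w; rewrite subrK.
    have : P.-integrable setT (EFin \o cst m) by exact: finite_measure_integrable_cst.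
    by move=> /(integrableD measurableT iA).
  move=> iA'; move: e; rewrite RintegralB//; last exact: finite_measure_integrable_cst.
  by rewrite EA Rintegral_probability_cst sub0r => /eqP; rewrite oppr_eq0 => /eqP.
subst m.
split => [k|k|b].
- have [] := H _ (mX k) => //.
  have := integrable_center_pow 0 sp k; rewrite (_ : (fun x => (x - 0) ^+ k) = fun x : R => x ^+ k)//.
  by apply/funext => x; rewrite subr0.
- have [] := H _ (mX k.*2).
    have := integrable_center_pow 0 sp k.*2; rewrite (_ : (fun x => (x - 0) ^+ _) = fun x : R => x ^+ k.*2)//.
    by apply/funext => x; rewrite subr0.
  move=> _ ->; rewrite -(integral_center_pow_even 0 sp).
  by apply: eq_Rintegral => x _; rewrite subr0.
- have [] := H _ (mcos b).
    by apply: (@integrable_poly_weight _ 0 s sp 0 1) => // x; rewrite mul1r cos_max.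
  move=> _ ->; have := normal_characteristic_function 0 sp 1 b.
  rewrite mul1r => <-; by apply: eq_Rintegral => x _; rewrite subr0 mul1r.
Qed.

End gaussian_law_facts.

Section gaussian_span.
Context {R : realType} d (T : measurableType d) (P : probability T R).
Context (I : Type) (X : I -> {RV P >-> R}).

Definition span (A : T -> R) : Prop :=
  exists (n : nat) (t : 'I_n -> I) (a : 'I_n -> R),
    A = fun w => \sum_(i < n) a i * X (t i) w.

Lemma span_ext A B : A =1 B -> span A -> span B.
Proof. by move=> /funext ->. Qed.

Lemma span_gen i : span (X i).
Proof.
exists 1%N, (fun=> i), (fun=> 1); apply/funext => w.
by rewrite big_ord1 mul1r.
Qed.

Lemma span0 : span (fun=> 0).
Proof.
have t (i : 'I_0) : I by case: i.
by exists 0%N, t, (fun=> 0); apply/funext => w; rewrite big_ord0.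
Qed.

Lemma spanD A B : span A -> span B -> span (fun w => A w + B w).
Proof.
move=> [n [t [a ->]]] [m [u [b ->]]].
exists (n + m)%N, (fun k => match fintype.split k with inl i => t i | inr j => u j end),
  (fun k => match fintype.split k with inl i => a i | inr j => b j end).
apply/funext => w; rewrite big_split_ord/=; congr (_ + _); apply: eq_bigr => i _.
- case: split_ordP => j /eqP; rewrite ?eq_lshift ?eq_lrshift// => /eqP e.
  by rewrite e.
- case: split_ordP => j /eqP; rewrite ?eq_rshift ?eq_rlshift// => /eqP e.
  by rewrite e.
Qed.

Lemma spanZ c A : span A -> span (fun w => c * A w).
Proof.
move=> [n [t [a ->]]]; exists n, t, (fun i => c * a i); apply/funext => w.
by rewrite mulr_sumr; apply: eq_bigr => i _; rewrite mulrA.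
Qed.

Lemma spanB A B : span A -> span B -> span (fun w => A w - B w).
Proof.
move=> sA sB; apply: span_ext (spanD sA (spanZ (-1) sB)) => w.
by rewrite mulN1r.
Qed.

Lemma span_sum (K : Type) (s : seq K) (F : K -> T -> R) :
  (forall k, span (F k)) -> span (fun w => \sum_(k <- s) F k w).
Proof.
move=> sF; elim: s => [|k s IH].
  by apply: span_ext span0 => w; rewrite big_nil.
by apply: span_ext (spanD (sF k) IH) => w; rewrite big_cons.
Qed.

Lemma span_measurable A : span A -> measurable_fun [set: T] A.
Proof.
move=> [n [t [a ->]]]; apply: measurable_sum => i.
exact: measurable_funM.
Qed.

Hypothesis gX : gaussian_process X.
Hypothesis cX : centred_process X.

Let span_law A : span A -> gaussian_law (pushforward P A).
Proof. by move=> [n [t [a ->]]]; exact: gX. Qed.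

Let gen_integrable i : P.-integrable setT (EFin \o X i).
Proof.
have /span_law gi := span_gen i.
have := cX i; rewrite unlock => ci.
have [|s [_ [h _ _]]] := centred_gaussian_law (span_measurable (span_gen i)) gi.
  by rewrite /Rintegral ci.
exact: (h 1%N).
Qed.

Let span_integral0 A : span A -> \int[P]_w A w = 0.
Proof.
move=> [n [t [a ->]]]; rewrite /Rintegral.
under eq_integral do rewrite -sumEFin.
rewrite integral_sum//; last first.
  by move=> i; have := integrableZl measurableT (a i) (gen_integrable (t i)).
rewrite big1//= => i _; under eq_integral do rewrite EFinM.
have := cX (t i); rewrite unlock => c0.
by rewrite integralZl ?c0 ?mule0//; exact: gen_integrable.
Qed.

(** The covariance, since all the variables it is applied to are centred. *)
Definition cov (A B : T -> R) : R := \int[P]_w (A w * B w).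

Lemma covC A B : cov A B = cov B A.
Proof. by rewrite /cov; under eq_Rintegral do rewrite mulrC. Qed.

Let span_facts A (sA : span A) :=
  centred_gaussian_law (span_measurable sA) (span_law sA) (span_integral0 sA).

Lemma span_integrable A k : span A -> P.-integrable setT (EFin \o (fun w => A w ^+ k)).
Proof. by move=> /span_facts[s [_ [h _ _]]]; exact: h. Qed.

Lemma span_integrableM A B : span A -> span B ->
  P.-integrable setT (EFin \o (fun w => A w * B w)).
Proof.
move=> sA sB.
have h := integrableD measurableT (span_integrable 2 sA) (span_integrable 2 sB).
apply: le_integrable h => //.
  by apply/measurable_EFinP/measurable_funM; exact: span_measurable.
move=> w _; rewrite -EFinD !abse_EFin lee_fin.
rewrite [leRHS]ger0_norm ?addr_ge0 ?sqr_ge0// ler_norml.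
have h1 := sqr_ge0 (A w + B w); have h2 := sqr_ge0 (A w - B w).
by apply/andP; split; nra.
Qed.

Lemma covDl A B C : span A -> span B -> span C ->
  cov (fun w => A w + B w) C = cov A C + cov B C.
Proof.
move=> sA sB sC; rewrite /cov; under eq_Rintegral do rewrite mulrDl.
by rewrite RintegralD//; exact: span_integrableM.
Qed.

Lemma covZl c A B : span A -> span B -> cov (fun w => c * A w) B = c * cov A B.
Proof.
move=> sA sB; rewrite /cov; under eq_Rintegral do rewrite -mulrA.
by rewrite RintegralZl//; exact: span_integrableM.
Qed.

Lemma covDr A B C : span A -> span B -> span C ->
  cov A (fun w => B w + C w) = cov A B + cov A C.
Proof. by move=> *; rewrite covC covDl// !(covC A). Qed.

Lemma covZr c A B : span A -> span B -> cov A (fun w => c * B w) = c * cov A B.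
Proof. by move=> *; rewrite covC covZl// covC. Qed.

Lemma covBl A B C : span A -> span B -> span C ->
  cov (fun w => A w - B w) C = cov A C - cov B C.
Proof.
move=> sA sB sC; rewrite -mulN1r -covZl// -covDl//; last exact: spanZ.
by rewrite /cov; apply: eq_Rintegral => w _; rewrite mulN1r.
Qed.

Lemma covBr A B C : span A -> span B -> span C ->
  cov A (fun w => B w - C w) = cov A B - cov A C.
Proof. by move=> *; rewrite covC covBl// !(covC A). Qed.

Lemma cov_suml (K : Type) (s : seq K) (F : K -> T -> R) B :
  (forall k, span (F k)) -> span B ->
  cov (fun w => \sum_(k <- s) F k w) B = \sum_(k <- s) cov (F k) B.
Proof.
move=> sF sB; elim: s => [|k s IH].
  rewrite big_nil /cov; under eq_Rintegral do rewrite big_nil mul0r.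
  exact: Rintegral_probability_cst.
rewrite big_cons -IH -covDl//; last exact: span_sum.
by rewrite /cov; apply: eq_Rintegral => w _; rewrite big_cons.
Qed.

Lemma cov_lincomb (K : Type) (s : seq K) (a : K -> R) (F : K -> T -> R) :
  (forall k, span (F k)) ->
  cov (fun w => \sum_(k <- s) a k * F k w) (fun w => \sum_(k <- s) a k * F k w) =
  \sum_(k <- s) \sum_(l <- s) a k * a l * cov (F k) (F l).
Proof.
move=> sF; have saF k : span (fun w => a k * F k w) by exact: spanZ.
rewrite cov_suml//; last exact: span_sum.
apply: eq_bigr => k _; rewrite covC cov_suml//.
apply: eq_bigr => l _; rewrite covZl// covZr// covC.
by ring.
Qed.

Let span_facts2 A : span A ->
  (forall k, \int[P]_w A w ^+ k.*2 = (\prod_(i < k) (i.*2).+1)%:R * cov A A ^+ k) /\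
  (forall b, \int[P]_w cos (A w + b) = expR (- cov A A / 2) * cos b).
Proof.
move=> /span_facts[s [_ [_ h1 h2]]].
have e : cov A A = s ^+ 2 by rewrite -[RHS]mul1r; have := h1 1%N; rewrite big_ord1.
by rewrite e; split => // k; rewrite h1 -exprM mul2n.
Qed.

Lemma span_characteristic_function A b : span A ->
  \int[P]_w cos (A w + b) = expR (- cov A A / 2) * cos b.
Proof. by move=> /span_facts2[]. Qed.

(** Markov's inequality for the moment of order 2k. *)
Lemma span_tail A (lambda : R) k : span A -> 0 < lambda ->
  (P [set w | lambda <= `|A w|]%R <=
   ((\prod_(i < k) (i.*2).+1)%:R * cov A A ^+ k / lambda ^+ k.*2)%:E)%E.
Proof.
move=> sA l0; have mA := span_measurable sA.
have mS : measurable [set w | lambda <= `|A w|].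
  rewrite -[mkset _]setTI; apply: measurable_fun_ler => //.
  exact: measurableT_comp.
rewrite -(span_facts2 sA).1.
have iA := span_integrable k.*2 sA.
rewrite EFinM -[leLHS]mule1 lee_pdivlMr ?exprn_gt0//.
rewrite mule1 muleC fineK; last exact: integrable_fin_num.
rewrite (probability_integral_indic P)// -ge0_integralZl//; last first.
  by rewrite lee_fin exprn_ge0// ltW.
  by apply/measurable_EFinP; exact: measurable_indic.
apply: ge0_le_integral => //.
- by move=> w _; rewrite mule_ge0// lee_fin exprn_ge0// ltW.
- by apply/measurable_EFinP/measurable_funM => //; exact: measurable_indic.
- exact: measurable_int iA.
move=> w _; rewrite -EFinM lee_fin indicE; case: (boolP (w \in _)) => [|_]; last first.
  by rewrite mulr0 -mul2n exprM exprn_ge0// sqr_ge0.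
rewrite inE/= mulr1 => h; rewrite -!mul2n !exprM -(real_normK (num_real (A w))).
by rewrite lerXn2r ?nnegrE ?sqr_ge0// lerXn2r ?nnegrE// ltW.
Qed.

End gaussian_span.

(** * Comparison and translation of Gaussian vectors *)
Section gaussian_comparison.
Context {R : realType} d (T : measurableType d) (P : probability T R).
Context (I : Type) (X : I -> {RV P >-> R}).
Hypothesis gX : gaussian_process X.
Hypothesis cX : centred_process X.
Local Notation span := (span X).
Local Notation cov := (cov P).

Let lincomb_cf (J : finType) (U : J -> T -> R) (a : J -> R) b : (forall j, span (U j)) ->
  \int[P]_w cos (\sum_j a j * U j w + b) =
  expR (- (\sum_j \sum_k a j * a k * cov (U j) (U k)) / 2) * cos b.
Proof.
move=> sU; rewrite -(cov_lincomb gX cX)//.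
apply: (span_characteristic_function gX cX).
by apply: span_sum => j; exact: spanZ.
Qed.

(** Two families with the same covariances have the same characteristic
function. *)
Lemma span_compare (J : finType) (U V : J -> T -> R) (c : J -> R) :
  (forall j, span (U j)) -> (forall j, span (V j)) ->
  (forall j k, cov (U j) (U k) = cov (V j) (V k)) ->
  (P [set w | forall j, U j w < c j]%R <= P [set w | forall j, V j w <= c j]%R)%E.
Proof.
move=> sU sV e; apply: probability_all_lt_le.
- by move=> j; exact: span_measurable (sU j).
- by move=> j; exact: span_measurable (sV j).
- move=> a b; rewrite (lincomb_cf a b sU) (lincomb_cf a b sV).
  rewrite (_ : \sum_j _ = \sum_j \sum_k a j * a k * cov (V j) (V k))//.
  by apply: eq_bigr => j _; apply: eq_bigr => k _; rewrite e.
Qed.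

Local Notation Q a := (P \x normal_prob a 1)%E.

(** The second coordinate of the product is a normal variable of mean a and
variance 1, independent of the process. *)
Let prod_cf (W : T -> R) (t a b : R) : span W ->
  \int[Q a]_z cos (W z.1 + t * z.2 + b) = expR (- (cov W W + t ^+ 2) / 2) * cos (b + t * a).
Proof.
move=> sW.
have mf : measurable_fun setT (fun z : T * measurableTypeR R => cos (W z.1 + t * z.2 + b)).
  apply: measurableT_comp; first by apply: continuous_measurable_fun; exact: continuous_cos.
  apply: measurable_funD => //; apply: measurable_funD.
    by apply: measurableT_comp => //; exact: span_measurable sW.
  by apply: measurable_funM => //.
have fi : (Q a).-integrable setT (EFin \o (fun z : T * measurableTypeR R => cos (W z.1 + t * z.2 + b))).
  by apply: (@bounded_integrable _ _ _ _ _ 1) => // z; exact: cos_max.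
rewrite /Rintegral -integral12_prod_meas1// /fubini_F /=.
transitivity (fine (\int[P]_x (expR (- t ^+ 2 / 2) * cos (W x + (b + t * a)))%:E)%E).
  congr fine; apply: eq_integral => w _.
  rewrite -[RHS]/((_)%:E) -[X in (_ * cos (_ + X))]/(b + t * a).
  have := @normal_characteristic_function R a 1 ltr01 t (W w + (b + t * a)).
  rewrite mulr1 => <-; rewrite /Rintegral fineK.
    by apply: eq_integral => x _; congr (cos _)%:E; ring.
  apply: integrable_fin_num => //.
  apply: (@bounded_integrable _ _ _ (normal_prob a 1) _ 1); last by move=> x; exact: cos_max.
  apply: measurableT_comp; first by apply: continuous_measurable_fun; exact: continuous_cos.
  apply: measurable_funD => //; apply: measurable_funM => //; exact: measurable_funB.
rewrite -/(Rintegral P setT (fun x => expR (- t ^+ 2 / 2) * cos (W x + (b + t * a)))).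
rewrite RintegralZl//; last first.
  apply: (@bounded_integrable _ _ _ _ _ 1); last by move=> x; exact: cos_max.
  apply: measurableT_comp; first by apply: continuous_measurable_fun; exact: continuous_cos.
  by apply: measurable_funD => //; exact: span_measurable sW.
rewrite (span_characteristic_function gX cX)// mulrA -expRD; congr (expR _ * _); by field.
Qed.

(** Let r be the standard deviation of Z and c_j = cov(U_j, Z) / r >= 2 eps.  The
part W_j of U_j that is uncorrelated with Z, plus c_j times an independent
normal variable xi, has the law of U_j if xi has law N(0, 1), and the law of
V_j - c_j if xi has law N(-1, 1).  So V < eps becomes W + c xi < eps - c <= - eps
under N(-1, 1), which [normal_prob_shift_le], applied to each section of the
product, compares with the same event under N(0, 1).  The loss from eps to
eps / 2 pays for the passage between open and closed orthants. *)
Lemma gaussian_shift (J : finType) (U V : J -> T -> R) (Z : T -> R) (eps K : R) (m : nat) :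
  (forall j, span (U j)) -> (forall j, span (V j)) -> span Z ->
  (forall j k, cov (U j) (U k) = cov (V j) (V k)) ->
  0 < eps -> 0 < K -> 0 < cov Z Z ->
  (forall j, 2 * eps * Num.sqrt (cov Z Z) <= cov (U j) Z) ->
  (P [set w | forall j, V j w < eps]%R <=
   K%:E * P [set w | forall j, U j w <= - (eps / 2)]%R +
   (expR ((m.+1%:R ^+ 2 - m.+1%:R) / 2) * K ^- m)%:E)%E.
Proof.
move=> sU sV sZ eUV eps0 K0 v0 UZ.
set v := cov Z Z in v0 UZ *; set r := Num.sqrt v in UZ.
have r0 : 0 < r by rewrite sqrtr_gt0.
have rr : r * r = v by rewrite -expr2 sqr_sqrtr// ltW.
pose c j := cov (U j) Z / r.
have c2 j : 2 * eps <= c j by rewrite ler_pdivlMr.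
(* W j is the part of U j uncorrelated with Z, and Y j puts back the removed
   multiple of Z / r with the independent second coordinate. *)
pose W j w := U j w - c j / r * Z w.
have sW j : span (W j) by apply: spanB => //; exact: spanZ.
pose Y j (z : T * measurableTypeR R) := W j z.1 + c j * z.2.
have mY j : measurable_fun setT (Y j).
  apply: measurable_funD; last exact: measurable_funM.
  by apply: measurableT_comp => //; exact: span_measurable (sW j).
have cf a (x : J -> R) b : \int[Q a]_z cos (\sum_j x j * Y j z + b) =
    expR (- (\sum_j \sum_k x j * x k * cov (U j) (U k)) / 2) *
    cos (b + (\sum_j x j * c j) * a).
  rewrite -(cov_lincomb gX cX)//.
  pose A w := \sum_j x j * U j w; rewrite -/A; set t := \sum_j x j * c j.
  have sA : span A by apply: span_sum => j; exact: spanZ.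
  have tE : cov A Z = t * r.
    rewrite (cov_suml gX cX)//; last by move=> j; exact: spanZ.
    rewrite mulr_suml; apply: eq_bigr => j _; rewrite (covZl gX cX)// -mulrA divfK//.
    by rewrite gt_eqF.
  have sAZ : span (fun w => A w - t / r * Z w) by apply: spanB => //; exact: spanZ.
  transitivity (\int[Q a]_z cos ((A z.1 - t / r * Z z.1) + t * z.2 + b)).
    apply: eq_Rintegral => z _; congr (cos (_ + _)).
    rewrite /Y /W /A /t -mulrA !mulr_suml -sumrB -big_split; apply: eq_bigr => j _ /=.
    by field; rewrite gt_eqF.
  rewrite (prod_cf t a b sAZ); congr (expR (- _ / 2) * _).
  have stZ : span (fun w => t / r * Z w) by exact: spanZ.
  rewrite (covBl gX cX)// !(covBr gX cX)// !(covZl gX cX)// !(covZr gX cX)// (covC P Z) tE -/v -rr.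
  by field; rewrite gt_eqF.
have mV j : measurable_fun [set: T] (V j) by exact: span_measurable (sV j).
apply: (@le_trans _ _ (Q (-1) [set z | forall j, Y j z <= eps - c j])).
  rewrite (_ : [set w | _] = [set w | forall j, V j w - c j < eps - c j]); last first.
    by apply/seteqP; split => w /= h j; have := h j; rewrite ltrD2r.
  apply: (@probability_all_lt_le R J _ T P _ _ (Q (-1)) (fun j w => V j w - c j)).
  - by move=> j; exact: measurable_funB.
  - exact: mY.
  - move=> x b; rewrite cf mulrN1.
    transitivity (\int[P]_w cos (\sum_j x j * V j w + (b - \sum_j x j * c j))).
      apply: eq_Rintegral => w _; congr cos; rewrite addrCA addrC; congr (_ + _).
      by rewrite -sumrB; apply: eq_bigr => j _; rewrite mulrBr.
    rewrite (lincomb_cf x _ sV).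
    rewrite (_ : \sum_j _ = \sum_j \sum_k x j * x k * cov (U j) (U k))//.
    by apply: eq_bigr => j _; apply: eq_bigr => k _; rewrite eUV.
pose B := [set z | forall j, Y j z <= - eps].
have mB : measurable B by exact: measurable_all_le.
apply: (@le_trans _ _ (Q (-1) B)).
  apply: le_measure; rewrite ?inE//; first exact: measurable_all_le.
  move=> z /= h j; apply: le_trans (h j) _; have := c2 j; lra.
set C := expR _ * _.
have C0 : 0 <= C by rewrite mulr_ge0 ?expR_ge0// invr_ge0 exprn_ge0// ltW.
apply: (@le_trans _ _ (K%:E * Q 0 B + C%:E)%E).
  rewrite /product_measure1/=.
  have mxs a : measurable_fun [set: T] (fun w => normal_prob a 1 (xsection B w)).
    exact: (measurable_fun_xsection (normal_prob a 1) mB).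
  have -> : (C%:E = \int[P]_w C%:E)%E.
    by rewrite integral_cst// [X in (_ * X)%E](_ : _ = 1%E) ?mule1//; exact: (probability_setT P).
  rewrite -ge0_integralZl//; last by rewrite lee_fin ltW.
  rewrite -ge0_integralD//; last 2 first.
    by move=> w _; rewrite mule_ge0// lee_fin ltW.
    exact: measurable_funeM.
  apply: ge0_le_integral => //.
  - by apply: emeasurable_funD => //; exact: measurable_funeM.
  - move=> w _; apply: normal_prob_shift_le => //; exact: measurable_xsection.
rewrite leeD// lee_wpmul2l ?lee_fin ?(ltW K0)//.
apply: (@le_trans _ _ (Q 0 [set z | forall j, Y j z < - (eps / 2)])).
  apply: le_measure; rewrite ?inE//; first exact: measurable_all_lt.
  by move=> z /= h j; apply: le_lt_trans (h j) _; lra.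
have H := @probability_all_lt_le R J _ _ (Q 0) _ T P Y U mY (fun j => span_measurable (sU j)) _ (fun=> - (eps / 2)).
apply: H => x b; by rewrite cf mulr0 addr0 lincomb_cf.
Qed.

End gaussian_comparison.

(** * Trigonometric inequalities *)
Section trigonometric_bounds.
Context {R : realType}.

Lemma sin_le (y : R) : 0 <= y -> sin y <= y.
Proof.
move=> y0; have [|c _] := @MVT_segment R sin cos 0 y y0.
  by apply: continuous_subspaceT; exact: continuous_sin.
rewrite sin0 !subr0 => ->.
by rewrite ler_piMl// cos_le1.
Qed.

Lemma cos_sqr_piquarter : cos (pi / 4) ^+ 2 = 2^-1 :> R.
Proof.
have := cos_mulr2n (pi / 4 : R); rewrite (_ : (pi / 4) *+ 2 = pi / 2); last by rewrite -mulr_natr; field.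
rewrite cos_pihalf -mulr_natr; lra.
Qed.

Lemma sin_ge_half (y : R) : 0 <= y <= pi / 2 -> y / 2 <= sin y.
Proof.
move=> /andP[y0 ypi]; have pi0 := pi_gt0 R.
set z := y / 2; have z0 : 0 <= z by rewrite /z; lra.
have zpi : z <= pi / 4 by rewrite /z; lra.
have q0 : 0 <= cos (pi / 4 : R) by apply: cos_ge0_pihalf; apply/andP; split; lra.
have le_cos c : 0 <= c <= z -> cos (pi / 4) <= cos c.
  move=> /andP[c0 cz]; have [->//|ne] := eqVneq c (pi / 4).
  apply: ltW; rewrite ltr_cos ?in_itv/= ?lt_neqAle ?ne//=; try (apply/andP; split); lra.
have [x xz e] : exists2 x, 0 <= x <= z & sin z = z * cos x.
  have [|c] := @MVT_segment R sin cos 0 z z0.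
    by apply: continuous_subspaceT; exact: continuous_sin.
  rewrite in_itv/= sin0 !subr0 => cz e; exists c => //; by rewrite e mulrC.
have -> : sin y = 2 * (cos z * sin z).
  have yE : y = z *+ 2 by rewrite /z -mulr_natr; field.
  by rewrite [in LHS]yE sin_mulr2n -mulr_natr mulrC.
rewrite e; have h1 := le_cos x xz; have h2 : cos (pi / 4) <= cos z by apply: le_cos; rewrite z0 lexx.
have h3 : cos (pi / 4) ^+ 2 <= cos z * cos x by rewrite expr2 ler_pM.
rewrite cos_sqr_piquarter in h3.
have : z * 2^-1 <= z * (cos z * cos x) by rewrite ler_wpM2l.
by rewrite (_ : z * (cos z * cos x) = cos z * (z * cos x)); [lra|ring].
Qed.

Lemma one_minus_cosE (t : R) : 1 - cos t = 2 * sin (t / 2) ^+ 2.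
Proof.
have := cos_mulr2n (t / 2); rewrite (_ : (t / 2) *+ 2 = t); last by rewrite -mulr_natr; field.
by move=> ->; rewrite cos2sin2 -mulr_natr; ring.
Qed.

Lemma one_minus_cos_le (t : R) : 0 <= t -> 1 - cos t <= t ^+ 2 / 2.
Proof.
move=> t0; wlog tpi : / t <= pi.
  move=> H; have [/H//|pit] := leP t pi.
  have := cos_geN1 t; have := pi_ge2 R; nra.
rewrite one_minus_cosE; have h : sin (t / 2) <= t / 2 by apply: sin_le; lra.
have h0 : 0 <= sin (t / 2) by apply: sin_ge0_pi; apply/andP; split; lra.
have : sin (t / 2) ^+ 2 <= (t / 2) ^+ 2 by rewrite lerXn2r ?nnegrE//; lra.
by rewrite expr_div_n; lra.
Qed.

Lemma one_minus_cos_ge (t : R) : 0 <= t <= pi -> t ^+ 2 / 8 <= 1 - cos t.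
Proof.
move=> /andP[t0 tpi]; rewrite one_minus_cosE.
have h : t / 2 / 2 <= sin (t / 2) by apply: sin_ge_half; apply/andP; split; lra.
have : (t / 2 / 2) ^+ 2 <= sin (t / 2) ^+ 2 by rewrite lerXn2r ?nnegrE//; lra.
by rewrite !expr_div_n; lra.
Qed.

(** The product of cosines is the cosine of the hypotenuse of a right-angled
spherical triangle with legs x and r; for r <= x the hypotenuse exceeds x by at
most r / 2, instead of the r given by the triangle inequality. *)
Lemma cos_add_half_le (x r : R) : 0 <= r <= 2^-1 -> r <= x -> x <= pi ->
  x + r / 2 <= pi -> cos (x + r / 2) <= cos x * cos r.
Proof.
move=> /andP[r0 r1] rx xpi xrpi; have pi2 := pi_ge2 R.
set h := r / 2; have h0 : 0 <= h by rewrite /h; lra.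
have rE : r = h *+ 2 by rewrite /h -mulr_natr; field.
have cosh : 9 / 10 <= cos h.
  have := one_minus_cos_le h0; rewrite /h expr_div_n; nra.
have sh0 : 0 <= sin h by apply: sin_ge0_pi; rewrite /h; apply/andP; split; lra.
have sx0 : 0 <= sin x by apply: sin_ge0_pi; apply/andP; split; lra.
have e := cos2Dsin2 h.
have cr : cos r = 2 * cos h ^+ 2 - 1 by rewrite rE cos_mulr2n -mulr_natr; ring.
have crh : cos r <= cos h by rewrite cr; have := cos_le1 h; nra.
rewrite cosD -subr_ge0.
have [cx|cx] := leP 0 (cos x); last by nra.
have sxr : sin r <= sin x.
  have [xp|xp] := leP x (pi / 2).
    have [->//|ne] := eqVneq r x.
    apply: ltW; rewrite ltr_sin ?in_itv/= ?lt_neqAle ?ne//=; try (apply/andP; split); lra.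
  have : cos x < 0 by rewrite -(cos_pihalf R) ltr_cos ?in_itv/=; try (apply/andP; split); lra.
  lra.
have sr : sin r = 2 * (cos h * sin h) by rewrite rE sin_mulr2n -mulr_natr; ring.
have k1 : cos h - cos r = (1 - cos h) * (1 + 2 * cos h) by rewrite cr; ring.
have k2 : (1 - cos h) * (1 + cos h) = sin h * sin h.
  by lra.
have ch1 := cos_le1 h; have cx1 := cos_le1 x.
(* (1 - cos h) (1 + 2 cos h) <= 3 (1 - cos h) <= (3 / 1.9) sin^2 h, which is
   below 2 cos h sin^2 h because cos h >= 9 / 10. *)
have k3 : cos h - cos r <= 2 * cos h * sin h * sin h.
  rewrite k1; have : (1 - cos h) * (1 + 2 * cos h) <= (2 * cos h) * ((1 - cos h) * (1 + cos h)).
    have : 0 <= (1 - cos h) * (2 * cos h * (1 + cos h) - (1 + 2 * cos h)).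
      by rewrite mulr_ge0//; nra.
    lra.
  by rewrite k2; lra.
have k4 : 2 * cos h * sin h * sin h <= sin x * sin h.
  by rewrite ler_wpM2r//; move: sxr; rewrite sr; lra.
have k5 : cos x * (cos h - cos r) <= cos h - cos r by rewrite ler_piMl//; lra.
lra.
Qed.

End trigonometric_bounds.

(** * Geodesic distance and reflections *)
Section dot_product.
Context {R : realType} {d : nat}.
Implicit Types (x y z : 'rV[R]_d).

Lemma dotC x y : dotprod x y = dotprod y x.
Proof. by apply: eq_bigr => i _; rewrite mulrC. Qed.

Lemma dotDl x y z : dotprod (x + y) z = dotprod x z + dotprod y z.
Proof. by rewrite -big_split; apply: eq_bigr => i _; rewrite mxE mulrDl. Qed.

Lemma dotZl a x y : dotprod (a *: x) y = a * dotprod x y.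
Proof. by rewrite mulr_sumr; apply: eq_bigr => i _; rewrite mxE mulrA. Qed.

Lemma dotBl x y z : dotprod (x - y) z = dotprod x z - dotprod y z.
Proof. by rewrite dotDl -scaleN1r dotZl mulN1r. Qed.

Lemma dotDr x y z : dotprod x (y + z) = dotprod x y + dotprod x z.
Proof. by rewrite dotC dotDl !(dotC x). Qed.

Lemma dotZr a x y : dotprod x (a *: y) = a * dotprod x y.
Proof. by rewrite dotC dotZl dotC. Qed.

Lemma dotBr x y z : dotprod x (y - z) = dotprod x y - dotprod x z.
Proof. by rewrite dotC dotBl !(dotC x). Qed.

Lemma dot_ge0 x : 0 <= dotprod x x.
Proof. by apply: sumr_ge0 => i _; rewrite -expr2 sqr_ge0. Qed.

Lemma dot_eq0 x : dotprod x x = 0 -> x = 0.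
Proof.
move=> /eqP; rewrite psumr_eq0 => [/allP h|i _]; last by rewrite -expr2 sqr_ge0.
apply/rowP => i; rewrite mxE; have := h i (mem_index_enum i).
by rewrite -expr2 sqrf_eq0 => /eqP.
Qed.

Lemma norm2_eq1 x : norm2 x = 1 <-> dotprod x x = 1.
Proof.
rewrite /norm2; split => [h|->]; last exact: sqrtr1.
by rewrite -(sqr_sqrtr (dot_ge0 x)) h expr1n.
Qed.

Lemma dot_subE x y : dotprod (x - y) (x - y) = dotprod x x + dotprod y y - 2 * dotprod x y.
Proof. by rewrite dotBl !dotBr (dotC y x); ring. Qed.

Lemma sqr_coord_le x i : x 0 i ^+ 2 <= dotprod x x.
Proof.
rewrite /dotprod (bigD1 i)//= -expr2 lerDl; apply: sumr_ge0 => j _.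
by rewrite -expr2 sqr_ge0.
Qed.

End dot_product.

Section sphere_points.
Context {R : realType} {d : nat}.
Local Notation sph := (sphere R d).
Implicit Types (x y : sph).

Definition sdot x y : R := dotprod (set_val x) (set_val y).

Lemma sdotxx x : sdot x x = 1.
Proof. by apply/norm2_eq1; have /set_mem := valP x. Qed.

Lemma sdotC x y : sdot x y = sdot y x.
Proof. exact: dotC. Qed.

Lemma sphere_mk (v : 'rV[R]_d) : dotprod v v = 1 -> exists x : sph, set_val x = v.
Proof.
move=> h; have vs : v \in sphere R d by rewrite inE; exact/norm2_eq1.
by exists (exist _ v vs).
Qed.

Lemma sdot_range x y : -1 <= sdot x y <= 1.
Proof.
have h1 := dot_ge0 (set_val x - set_val y); have h2 := dot_ge0 (set_val x + set_val y).
move: h1 h2; rewrite dot_subE dotDl !dotDr -!/(sdot _ _) !sdotxx (sdotC y x).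
by move=> *; apply/andP; split; lra.
Qed.

Lemma geodist_range x y : 0 <= geodist x y <= pi.
Proof. by rewrite acos_ge0 ?acos_lepi ?sdot_range. Qed.

Lemma cos_geodist x y : cos (geodist x y) = sdot x y.
Proof. by rewrite /geodist acosK// in_itv/= sdot_range. Qed.

Lemma geodistC x y : geodist x y = geodist y x.
Proof. by rewrite /geodist dotC. Qed.

Lemma geodist_eq (x y x' y' : sph) : sdot x y = sdot x' y' -> geodist x y = geodist x' y'.
Proof. by rewrite /geodist -!/(sdot _ _) => ->. Qed.

Lemma geodistxx x : geodist x x = 0.
Proof. by rewrite /geodist -/(sdot _ _) sdotxx acos1. Qed.

Lemma geodist_le_cos x y (t : R) : 0 <= t -> (t <= pi -> cos t <= sdot x y) -> geodist x y <= t.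
Proof.
move=> t0 h; have /andP[g0 gpi] := geodist_range x y.
have [tpi|/ltW tpi] := leP t pi; last exact: le_trans tpi.
have := h tpi; rewrite -cos_geodist leNgt => hc; rewrite leNgt; apply: contra hc => tg.
by rewrite ltr_cos ?in_itv/= ?t0 ?tpi ?g0 ?gpi.
Qed.

Lemma geodist_eq_cos x y (t : R) : 0 <= t <= pi -> sdot x y = cos t -> geodist x y = t.
Proof. by move=> ht; rewrite /geodist -/(sdot x y) => ->; rewrite cosK// in_itv/=. Qed.

(** By 1 - cos t >= t^2 / 8 on [0, pi], an arc is at most twice its chord. *)
Lemma geodist_le_sqr x y (u : R) : 0 <= u ->
  dotprod (set_val x - set_val y) (set_val x - set_val y) <= u ^+ 2 -> geodist x y <= 2 * u.
Proof.
move=> u0; rewrite dot_subE -!/(sdot _ _) !sdotxx => h.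
have := one_minus_cos_ge (geodist_range x y); rewrite cos_geodist => h2.
have /andP[g0 _] := geodist_range x y.
rewrite -(@ler_pXn2r _ 2)// ?nnegrE//; last by lra.
by rewrite exprMn; lra.
Qed.

(** By 1 - cos t <= t^2 / 2, a chord is at most its arc; it dominates every
coordinate of the difference. *)
Lemma coord_le_geodist x y i : `|set_val x 0 i - set_val y 0 i| <= geodist x y.
Proof.
have /andP[g0 _] := geodist_range x y.
have := one_minus_cos_le g0; rewrite cos_geodist => h.
rewrite -(@ler_pXn2r _ 2)// ?nnegrE// real_normK ?num_real//.
have := sqr_coord_le (set_val x - set_val y) i; rewrite !mxE => /le_trans; apply.
by rewrite dot_subE -!/(sdot _ _) !sdotxx; lra.
Qed.

(** The Householder reflection along p - q. *)
Lemma reflection_exists (p q : sph) : exists rho : sph -> sph,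
  [/\ forall x y, sdot (rho x) (rho y) = sdot x y,
      forall x, rho (rho x) = x & rho p = q].
Proof.
have [->|npq] := eqVneq p q; first by exists id.
have [u uE] : exists u : 'rV[R]_d, u = set_val p - set_val q by eexists.
have u0 : dotprod u u != 0.
  apply: contra npq => /eqP /dot_eq0 /eqP; rewrite uE subr_eq0 => /eqP e.
  by apply/eqP/val_inj.
pose f (v : 'rV[R]_d) := v - (2 * dotprod v u / dotprod u u) *: u.
have ff v w : dotprod (f v) (f w) = dotprod v w.
  rewrite /f dotBl !dotBr !dotZl !dotZr (dotC u w); by field.
have fK v : f (f v) = v.
  have e : dotprod (f v) u = - dotprod v u by rewrite /f dotBl dotZl; field.
  rewrite {1}/f e {1}/f mulrN mulNr scaleNr opprK subrK//.
have fs x : f (set_val x) \in sphere R d.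
  rewrite inE; apply/norm2_eq1; rewrite ff; exact: sdotxx.
exists (fun x => exist _ (f (set_val x)) (fs x)); split.
- by move=> x y; rewrite /sdot ff.
- by move=> x; apply: val_inj; rewrite /= fK.
- apply: val_inj => /=; rewrite /f.
  have : 2 * dotprod (set_val p) u = dotprod u u.
    by rewrite uE dot_subE dotBr -!/(sdot _ _) !sdotxx; ring.
  by move=> ->; rewrite divff// scale1r uE opprB addrC subrK.
Qed.

End sphere_points.

(** * Opposite points at a given distance *)
Section test_points.
Context {R : realType} {d : nat}.
Local Notation sph := (sphere R d).

Lemma dot_delta (i j : 'I_d) :
  dotprod (delta_mx 0 i : 'rV[R]_d) (delta_mx 0 j) = (i == j)%:R.
Proof.
rewrite /dotprod (bigD1 i)//= !mxE !eqxx/= mul1r big1 ?addr0// => k /negPf ki.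
by rewrite !mxE ki andbF mul0r.
Qed.

Lemma orthogonal_exists (p : sph) : (2 <= d)%N -> exists e : sph, sdot e p = 0.
Proof.
move=> hd; pose i0 := Ordinal (ltnW hd); pose i1 := Ordinal hd.
have mk i : exists x : sph, set_val x = delta_mx 0 i.
  by apply: sphere_mk; rewrite dot_delta eqxx.
have [e0 h0] := mk i0; have [e1 h1] := mk i1.
have [rho [rd rK rp]] := reflection_exists p e0.
exists (rho e1); rewrite -rd rK rp /sdot h0 h1 dot_delta.
by rewrite -val_eqE.
Qed.

(** The points are cos r p + sin r e and cos r p - sin r e, where e is orthogonal
to p.  Every eta lies on one side of the hyperplane orthogonal to e, so the
angle at p between eta and one of the two points is at most a right angle. *)
Lemma two_points_exist (p : sph) (r : R) : (2 <= d)%N -> 0 <= r <= pi ->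
  exists zeta zeta' : sph,
  [/\ sdot zeta p = cos r, sdot zeta' p = cos r, sdot zeta zeta' = cos (2 * r) &
    forall eta : sph,
      [/\ sdot eta p * cos r <= sdot eta zeta \/ sdot eta p * cos r <= sdot eta zeta',
          cos (geodist eta p + r) <= sdot eta zeta &
          cos (geodist eta p + r) <= sdot eta zeta']].
Proof.
move=> hd /andP[r0 rpi]; have [e ep] := orthogonal_exists p hd.
have sr0 : 0 <= sin r by apply: sin_ge0_pi; rewrite r0.
have cs := cos2Dsin2 r.
pose v (s : R) := cos r *: set_val p + (s * sin r) *: set_val e.
have vv (s : R) (t : R) : dotprod (v s) (v t) = cos r ^+ 2 + s * t * sin r ^+ 2.
  rewrite /v !dotDl !dotDr !dotZl !dotZr -!/(sdot _ _) !sdotxx (sdotC p) ep; ring.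
have [z hz] : exists x : sph, set_val x = v 1 by apply: sphere_mk; rewrite vv !mul1r.
have [z' hz'] : exists x : sph, set_val x = v (-1).
  by apply: sphere_mk; rewrite vv mulrNN !mul1r.
have dv (x : sph) s : dotprod (set_val x) (v s) = cos r * sdot x p + s * sin r * sdot x e.
  by rewrite /v dotDr !dotZr.
exists z, z'; split.
- by rewrite sdotC /sdot hz dv sdotxx (sdotC p) ep mulr1 mulr0 addr0.
- by rewrite sdotC /sdot hz' dv sdotxx (sdotC p) ep mulr1 mulr0 addr0.
- rewrite /sdot hz hz' vv (_ : 2 * r = r *+ 2); last by rewrite mulr_natl.
  by rewrite cos_mulr2n sin2cos2; ring.
move=> eta; rewrite /sdot hz hz' !dv mul1r mulN1r -/(sdot _ _).
set a := sdot eta p; set b := sdot eta e.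
have ab : a ^+ 2 + b ^+ 2 <= 1.
  have := dot_ge0 (set_val eta - (a *: set_val p + b *: set_val e)).
  rewrite dot_subE !dotDl !dotDr !dotZl !dotZr -!/(sdot _ _) !sdotxx (sdotC p) ep -/a -/b.
  by move=> h; rewrite -subr_ge0; apply: le_trans h _; rewrite le_eqVlt; apply/orP; left; apply/eqP; ring.
have ca : cos (geodist eta p) = a by rewrite cos_geodist.
have sx0 : 0 <= sin (geodist eta p) by apply: sin_ge0_pi; exact: geodist_range.
have cs2 := cos2Dsin2 (geodist eta p); rewrite ca in cs2.
have /andP[b1 b2] : - sin (geodist eta p) <= b <= sin (geodist eta p).
  rewrite -ler_norml -(@ler_pXn2r _ 2)// ?nnegrE// real_normK ?num_real//; lra.
rewrite cosD ca.
have p1 : - (sin (geodist eta p) * sin r) <= b * sin r by rewrite -mulNr ler_wpM2r.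
have p2 : b * sin r <= sin (geodist eta p) * sin r by rewrite ler_wpM2r.
split; [|lra|lra].
have [b0|b0] := leP 0 b.
  by left; have := mulr_ge0 b0 sr0; lra.
right; have bs : b * sin r <= 0 by rewrite mulr_le0_ge0// ltW.
lra.
Qed.

(** The form of [two_points_exist] in terms of distances: one of the two points
is closer to eta than the triangle inequality says, by r / 2. *)
Lemma test_points_exist (p : sph) (r : R) : (2 <= d)%N -> 0 < r <= 2^-1 ->
  exists zeta zeta' : sph,
  [/\ geodist zeta p = r, geodist zeta' p = r, geodist zeta zeta' = 2 * r &
    forall eta : sph, r <= geodist eta p ->
      let x := geodist eta p in
      (geodist eta zeta <= x + r / 2 /\ geodist eta zeta' <= x + r) \/
      (geodist eta zeta' <= x + r / 2 /\ geodist eta zeta <= x + r)].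
Proof.
move=> hd /andP[r0 r1]; have pi2 := pi_ge2 R.
have [|z [z' [h1 h2 h3 h4]]] := @two_points_exist p r hd; first by apply/andP; split; lra.
exists z, z'; split.
- by apply: geodist_eq_cos => //; apply/andP; split; lra.
- by apply: geodist_eq_cos => //; apply/andP; split; lra.
- by apply: geodist_eq_cos => //; apply/andP; split; lra.
move=> eta rx x; have [h5 h6 h7] := h4 eta.
have /andP[x0 xpi] := geodist_range eta p.
have far y : cos (geodist eta p + r) <= sdot eta y -> geodist eta y <= x + r.
  by move=> h; apply: geodist_le_cos => //; rewrite /x; lra.
have near_ y : sdot eta p * cos r <= sdot eta y -> geodist eta y <= x + r / 2.
  move=> h; apply: geodist_le_cos; first by rewrite /x; lra.
  move=> xr; apply: le_trans h; rewrite -cos_geodist; apply: cos_add_half_le => //.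
  by apply/andP; split; lra.
by case: h5 => h; [left|right]; split; [exact: near_|exact: far|exact: near_|exact: far].
Qed.

End test_points.

(** * Separated families and nets *)
Section sphere_discretization.
Context {R : realType} {d' : nat}.
Local Notation d := d'.+1.
Local Notation sph := (sphere R d).

(** A grid of mesh 1 / (n d) in the last d' coordinates, lifted to the upper
hemisphere by the first one; this keeps the grid points apart because distances
dominate differences of coordinates. *)
Lemma separated_exists (n : nat) : (0 < n)%N ->
  exists q : {ffun 'I_d' -> 'I_n} -> sph,
    forall i j, i != j -> (n%:R * d%:R)^-1 <= geodist (q i) (q j).
Proof.
move=> n0; pose r : R := (n%:R * d%:R)^-1.
have nd0 : 0 < n%:R * d%:R :> R by rewrite mulr_gt0// ltr0n.
have r0 : 0 < r by rewrite invr_gt0.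
have dd0 : 0 < d%:R :> R by rewrite ltr0n.
pose x (f : {ffun 'I_d' -> 'I_n}) (j : 'I_d') : R := (f j)%:R * r.
have x2 f : \sum_j x f j ^+ 2 <= 1.
  apply: (@le_trans _ _ (\sum_(j < d') d%:R^-1)).
    apply: ler_sum => j _; rewrite /x /r.
    have h : (f j)%:R * (n%:R * d%:R)^-1 <= d%:R^-1 :> R.
      rewrite ler_pdivrMr// mulrCA mulVf ?gt_eqF// mulr1 ler_nat ltnW//.
    have h0 : 0 <= (f j)%:R * (n%:R * d%:R)^-1 :> R by rewrite mulr_ge0// ltW.
    have d1 : d%:R^-1 <= 1 :> R by rewrite invf_le1// ler1n.
    rewrite expr2 (le_trans (ler_wpM2l h0 h))// (le_trans _ h)// ler_piMr//.
  rewrite sumr_const card_ord -[X in X <= _]mulr_natl ler_pdivrMr// mul1r ler_nat leqnSn//.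
pose v f : 'rV[R]_d := \row_i
  if unlift ord0 i is Some j then x f j else Num.sqrt (1 - \sum_j x f j ^+ 2).
have vv f : dotprod (v f) (v f) = 1.
  rewrite /dotprod big_ord_recl !mxE unlift_none -expr2 sqr_sqrtr ?subr_ge0//.
  rewrite [X in _ + X](eq_bigr (fun j => x f j ^+ 2)) ?subrK// => j _.
  by rewrite !mxE liftK expr2.
pose q f : sph := sval (cid (sphere_mk (vv f))).
have qE f : set_val (q f) = v f by rewrite /q; case: cid.
exists q => f g fg.
have [a fga] : exists a, f a != g a.
  apply/existsP; rewrite -negb_forall; apply: contra fg => /forallP h.
  by apply/eqP/ffunP => a; apply/eqP/h.
apply: le_trans (coord_le_geodist _ _ (lift ord0 a)); rewrite !qE !mxE liftK.
rewrite /x -mulrBl normrM (ger0_norm (ltW r0)) ler_peMl ?(ltW r0)//.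
have : (f a != g a :> nat) by rewrite -val_eqE in fga.
rewrite neq_ltn => /orP[h|h].
- by rewrite ler0_norm ?subr_le0 ?ler_nat ?(ltnW h)// opprB -natrB ?(ltnW h)// ler1n subn_gt0.
- by rewrite ger0_norm ?subr_ge0 ?ler_nat ?(ltnW h)// -natrB ?(ltnW h)// ler1n subn_gt0.
Qed.

Lemma truncn_eq_dist (a b : R) : 0 <= a -> 0 <= b -> Num.truncn a = Num.truncn b -> `|a - b| <= 1.
Proof.
move=> a0 b0 e; have /andP[a1 a2] := truncn_itv a0; have /andP[b1 b2] := truncn_itv b0.
rewrite e -natr1 in a1 a2; rewrite -natr1 in b2.
by rewrite ler_norml; apply/andP; split; lra.
Qed.

(** A point is located by a coordinate of modulus at least 1 / d, which exists
because the squares of the coordinates sum to 1, by the sign of that coordinate,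
and by the other coordinates rounded to mesh 1 / n. *)
Let cell (n : nat) (c : 'I_d * bool * {ffun 'I_d' -> 'I_(n.*2).+1}) (eta : sph) : Prop :=
  [/\ d%:R^-1 <= `|set_val eta 0 c.1.1|, c.1.2 = (0 <= set_val eta 0 c.1.1) &
      forall j, c.2 j = Num.truncn ((set_val eta 0 (lift c.1.1 j) + 1) * n%:R) :> nat].

Let sph_coord (x : sph) i : -1 <= set_val x 0 i <= 1.
Proof.
have h : set_val x 0 i ^+ 2 <= 1 by rewrite -(sdotxx x) sqr_coord_le.
rewrite -ler_norml -(@ler_pXn2r _ 2)// ?nnegrE// real_normK ?num_real// expr1n//.
Qed.

Let cell_exists n eta : (0 < n)%N -> exists c, @cell n c eta.
Proof.
move=> n0; have d0 : 0 < d%:R :> R by rewrite ltr0n.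
have [k hk] : exists k, d%:R^-1 <= `|set_val eta 0 k|.
  apply: contrapT => /forallNP h.
  have : sdot eta eta < \sum_(k < d) d%:R^-1.
    apply: ltr_sum; first by apply/hasP; exists ord0; rewrite ?mem_index_enum.
    move=> k _; have /negP := h k; rewrite -ltNge => hk.
    rewrite -expr2 -real_normK ?num_real// expr2.
    apply: (@le_lt_trans _ _ (`|set_val eta 0 k| * 1)); last by rewrite mulr1.
    by rewrite ler_wpM2l// ler_norml sph_coord.
  by rewrite sdotxx sumr_const card_ord -[X in _ < X]mulr_natl divff ?ltxx// gt_eqF.
pose a (j : 'I_d') := Num.truncn ((set_val eta 0 (lift k j) + 1) * n%:R).
have aP j : (a j < (n.*2).+1)%N.
  rewrite ltnS /a -(ler_nat R); have /andP[h1 h2] := sph_coord eta (lift k j).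
  apply: (@le_trans _ _ ((set_val eta 0 (lift k j) + 1) * n%:R)).
    have := @truncn_itv _ ((set_val eta 0 (lift k j) + 1) * n%:R).
    by rewrite mulr_ge0//; [move=> /(_ isT)/andP[]|lra].
  by rewrite -mul2n natrM ler_wpM2r//; lra.
exists (k, 0 <= set_val eta 0 k, [ffun j => Ordinal (aP j)]); split => //= j.
by rewrite ffunE.
Qed.

(** In a cell the square of the distinguished coordinate k is a function of the
others; having a fixed sign and modulus at least 1 / d, coordinate k is
therefore a Lipschitz function of the others. *)
Let cell_dist n c (eta zeta : sph) : (0 < n)%N -> @cell n c eta -> @cell n c zeta ->
  geodist eta zeta <= 2 * ((d' * d + d')%:R / n%:R).
Proof.
move=> n0 [k1 s1 f1] [k2 s2 f2]; case: c k1 s1 f1 k2 s2 f2 => [[k s] f] /=.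
set x := set_val eta; set y := set_val zeta => k1 s1 f1 k2 s2 f2.
have n0' : 0 < n%:R :> R by rewrite ltr0n.
have d0 : 0 < d%:R :> R by rewrite ltr0n.
have hj j : `|x 0 (lift k j) - y 0 (lift k j)| <= n%:R^-1.
  have /andP[hx1 hx2] := sph_coord eta (lift k j).
  have /andP[hy1 hy2] := sph_coord zeta (lift k j).
  have p1 : 0 <= (x 0 (lift k j) + 1) * n%:R by rewrite mulr_ge0//; lra.
  have p2 : 0 <= (y 0 (lift k j) + 1) * n%:R by rewrite mulr_ge0//; lra.
  have := truncn_eq_dist p1 p2; rewrite -f1 -f2 => /(_ erefl).
  rewrite -mulrBl normrM (ger0_norm (ltW n0')) -ler_pdivlMr// mul1r.
  by rewrite opprD addrACA subrr addr0.
have dotE (v : 'rV[R]_d) :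
    dotprod v v = v 0 k ^+ 2 + \sum_(j < d') v 0 (lift k j) ^+ 2.
  rewrite /dotprod (bigD1_ord k)//= -expr2; congr (_ + _).
have hk : `|x 0 k - y 0 k| <= (d' * d)%:R / n%:R.
  have e : x 0 k ^+ 2 - y 0 k ^+ 2 =
      \sum_(j < d') (y 0 (lift k j) ^+ 2 - x 0 (lift k j) ^+ 2).
    rewrite sumrB; have := sdotxx zeta; have := sdotxx eta.
    by rewrite /sdot !dotE -/x -/y; lra.
  have a1 : 2 / d%:R * `|x 0 k - y 0 k| <= `|x 0 k ^+ 2 - y 0 k ^+ 2|.
    rewrite subr_sqr normrM mulrC ler_wpM2l//.
    have : `|x 0 k + y 0 k| = `|x 0 k| + `|y 0 k|.
      case: (leP 0 (x 0 k)) s1 => [x0|x0] s1.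
        have y0 : 0 <= y 0 k by rewrite -s2 s1.
        by rewrite !ger0_norm ?addr_ge0.
      have y0 : y 0 k < 0 by rewrite ltNge -s2 s1.
      by rewrite !ltr0_norm// ?opprD//; lra.
    move=> ->; rewrite (_ : 2 / d%:R = d%:R^-1 + d%:R^-1); first exact: lerD.
    by rewrite mulrDl mul1r.
  have a2 : `|x 0 k ^+ 2 - y 0 k ^+ 2| <= d'%:R * (2 / n%:R).
    rewrite e; apply: le_trans (ler_norm_sum _ _ _) _.
    apply: (@le_trans _ _ (\sum_(j < d') 2 / n%:R)); last first.
      by rewrite sumr_const card_ord -[X in X <= _]mulr_natl.
    apply: ler_sum => j _; rewrite subr_sqr normrM distrC mulrC ler_pM//.
    rewrite (le_trans (ler_normD _ _))//.
    have h1 : `|x 0 (lift k j)| <= 1 by rewrite ler_norml sph_coord.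
    have h2 : `|y 0 (lift k j)| <= 1 by rewrite ler_norml sph_coord.
    lra.
  have := le_trans a1 a2; rewrite -ler_pdivlMl; last by rewrite divr_gt0.
  move=> /le_trans; apply; rewrite natrM invf_div le_eqVlt; apply/orP; left; apply/eqP.
  by field; rewrite !gt_eqF.
apply: geodist_le_sqr; first by rewrite divr_ge0.
rewrite -/x -/y dotE !mxE -(real_normK (num_real (x 0 k - y 0 k))).
have b1 : `|x 0 k - y 0 k| ^+ 2 <= ((d' * d)%:R / n%:R) ^+ 2 by rewrite lerXn2r ?nnegrE ?divr_ge0.
have b2 : \sum_(j < d') (x - y) 0 (lift k j) ^+ 2 <= d'%:R * n%:R^-1 ^+ 2.
  apply: (@le_trans _ _ (\sum_(j < d') n%:R^-1 ^+ 2)); last first.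
    by rewrite sumr_const card_ord -[X in X <= _]mulr_natl.
  apply: ler_sum => j _; rewrite !mxE -real_normK ?num_real//.
  by rewrite lerXn2r ?nnegrE ?invr_ge0.
apply: le_trans (lerD b1 b2) _.
have dd : d'%:R <= d'%:R ^+ 2 :> R.
  by rewrite -natrX ler_nat; case: (d') => // m; rewrite -mulnn leq_pmull.
have ad : 0 <= (d' * d)%:R * d'%:R :> R by rewrite mulr_ge0.
rewrite !expr_div_n exprVn -mulrDl ler_wpM2r ?invr_ge0 ?sqr_ge0// natrD sqrrD.
by rewrite -[(_ * _) *+ 2]mulr_natl; lra.
Qed.

(** One point chosen in each nonempty cell; empty cells receive the point O. *)
Lemma net_exists (O : sph) : exists C : R, 0 < C /\ forall n, (0 < n)%N ->
  exists (J : finType) (q : J -> sph), #|J|%:R <= C * n%:R ^+ d' /\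
    forall eta, exists j, geodist eta (q j) <= C / n%:R.
Proof.
pose C1 : R := (d * 2 * 3 ^ d')%:R; pose C2 : R := 2 * (d' * d + d')%:R.
have C10 : 0 < C1 by rewrite ltr0n !muln_gt0 expn_gt0.
have C20 : 0 <= C2 by rewrite mulr_ge0.
exists (C1 + C2); split; first by rewrite ltr_pwDl.
move=> n n0; exists ('I_d * bool * {ffun 'I_d' -> 'I_(n.*2).+1})%type.
exists (fun c => xget O [set eta | cell c eta]); split.
  rewrite !card_prod card_bool card_ffun !card_ord.
  apply: (@le_trans _ _ (C1 * n%:R ^+ d')); last by rewrite ler_wpM2r ?exprn_ge0// lerDl.
  rewrite /C1 -natrX -natrM ler_nat -[leqRHS]mulnA leq_mul// -expnMn.
  have n3 : ((n.*2).+1 <= 3 * n)%N by rewrite mulSn mul2n -addn1 addnC leq_add2r.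
  by case: (d') => // m; rewrite leq_exp2r.
move=> eta; have [c hc] := cell_exists eta n0; exists c.
have h : cell c (xget O [set eta | cell c eta]) by have := @xgetPex _ O [set eta | cell c eta]; apply; exists eta.
apply: le_trans (cell_dist n0 hc h) _.
by rewrite mulrA ler_wpM2r ?invr_ge0// lerDr ltW.
Qed.

End sphere_discretization.

(** * Convergence, powers and union bounds *)
Section sphere_topology.
Context {R : realType} {d : nat}.
Local Notation sph := (sphere R d).

Lemma cvg_geodist (y : nat -> sph) (x : sph) :
  (fun n => geodist x (y n)) @ \oo --> (0 : R) -> y @ \oo --> x.
Proof.
move=> h; apply/cvg_ballP => e e0.
move/cvgrPdist_lt : h => /(_ e e0); apply: filterS => n /= hn.
rewrite -initial_ballE; split => // i j; rewrite /ball/= (ord1 i).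
apply: le_lt_trans (coord_le_geodist x (y n) j) _; apply: le_lt_trans hn.
by rewrite sub0r normrN ler_norm.
Qed.

End sphere_topology.

Section real_powers.
Context {R : realType}.

(** For z <= s the ratio z / s is at most (z / s)^a; apply this to z = x and
z = y with s = x + y. *)
Lemma powR_subadditive (a x y : R) : 0 <= a <= 1 -> 0 <= x -> 0 <= y ->
  (x + y) `^ a <= x `^ a + y `^ a.
Proof.
move=> /andP[a0 a1] x0 y0.
have [s0|s0] := leP (x + y) 0.
  have xe : x = 0 by lra.
  have ye : y = 0 by lra.
  by rewrite xe ye addr0 lerDl powR_ge0.
have h z : 0 <= z -> z <= x + y -> z / (x + y) * (x + y) `^ a <= z `^ a.
  move=> z0 zs; have [->|zn] := eqVneq z 0; first by rewrite !mul0r powR_ge0.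
  have zp : 0 < z by rewrite lt_def zn.
  have -> : z `^ a = (z / (x + y)) `^ a * (x + y) `^ a.
    by rewrite -powRM ?divr_ge0 ?(ltW s0)// divfK// gt_eqF.
  rewrite ler_wpM2r ?powR_ge0//.
  apply: ger1_powR => //; rewrite divr_gt0//= ler_pdivrMr// mul1r//.
have xs : x <= x + y by lra.
have ys : y <= x + y by lra.
have h1 := h y y0 ys; have h2 := h x x0 xs.
have e : (x + y) `^ a = x / (x + y) * (x + y) `^ a + y / (x + y) * (x + y) `^ a.
  by rewrite -mulrDl -mulrDl divff ?mul1r// gt_eqF.
by rewrite e lerD.
Qed.

Lemma ge0_le_powR (a x y : R) : 0 <= a -> 0 <= x -> x <= y -> x `^ a <= y `^ a.
Proof.
by move=> a0 x0 xy; apply: ge0_ler_powR => //; rewrite nnegrE// (le_trans x0).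
Qed.

Lemma powR2N_lt1 (a : R) : 0 < a -> 2 `^ (- a) < 1.
Proof.
move=> a0; rewrite powRN invf_lt1 ?powR_gt0//.
by have := @gt0_ltr_powR R a a0 1 2; rewrite powR1; apply; rewrite ?nnegrE// ltr1n.
Qed.

End real_powers.

(** The sum of the indicators of disjoint events is at most 1. *)
Lemma sum_disjoint_probability_le1 d (T : measurableType d) (R : realType)
  (P : probability T R) (J : finType) (F : J -> set T) :
  (forall j, measurable (F j)) -> (forall i j w, F i w -> F j w -> i = j) ->
  (\sum_j P (F j) <= 1)%E.
Proof.
move=> mF disj.
under eq_bigr do rewrite (probability_integral_indic P)//.
rewrite -ge0_integral_sum//; last first.
  by move=> j; apply/measurable_EFinP; exact: measurable_indic.
apply: (@le_trans _ _ (\int[P]_w 1)%E); last first.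
  by rewrite integral_cst// mul1e; exact: probability_le1.
apply: ge0_le_integral => //.
- by move=> w _; apply: sume_ge0 => j _; rewrite lee_fin.
- by apply: emeasurable_sum => j; apply/measurable_EFinP; exact: measurable_indic.
- move=> w _; rewrite sumEFin lee_fin.
  have [[i Fi]|nF] := pselect (exists i, F i w); last first.
    rewrite big1// => j _; rewrite indicE memNset// => Fj; apply: nF; by exists j.
  rewrite (bigD1 i)//= big1 ?addr0 ?indicE; first by case: (_ \in _).
  by move=> j ji; rewrite indicE memNset// => Fj; move/eqP : ji; apply; exact: disj Fj Fi.
Qed.

Section union_bounds.
Context d (T : measurableType d) (R : realType) (P : probability T R).

Lemma finite_union_bound (J : finType) (F : J -> set T) :
  (forall j, measurable (F j)) ->
  measurable [set w | exists j, F j w] /\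
  (P [set w | exists j, F j w] <= \sum_j P (F j))%E.
Proof.
move=> mF.
suff H (s : seq J) : let A := [set w | exists2 j, j \in s & F j w] in
    measurable A /\ (P A <= \sum_(j <- s) P (F j))%E.
  have [h1 h2] := H (index_enum J).
  suff <- : [set w | exists2 j, j \in index_enum J & F j w] = [set w | exists j, F j w] by [].
  apply/seteqP; split => w /=; first by move=> [j _ h]; exists j.
  by move=> [j h]; exists j => //; exact: mem_index_enum.
elim: s => [|j s [IH1 IH2]] /=.
  rewrite (_ : mkset _ = set0); first by rewrite measure0 big_nil.
  by apply/seteqP; split => w //= -[].
rewrite (_ : mkset _ = F j `|` [set w | exists2 j, j \in s & F j w]); last first.
  apply/seteqP; split => w /=.
    by move=> [i]; rewrite inE => /predU1P[->|is_ h]; [left|right; exists i].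
  move=> [h|[i is_ h]]; first by exists j; rewrite // inE eqxx.
  by exists i => //; rewrite inE is_ orbT.
split; first exact: measurableU.
by rewrite big_cons (le_trans (measureU2 _ _ _))// leeD2l.
Qed.

Lemma geometric_union_bound (F : nat -> set T) (r : R) (K : nat) :
  (forall k, measurable (F k)) ->
  (forall k, P (F k) <= (r / (2 ^ (k + K.+1))%:R)%:E)%E ->
  (P (\bigcup_k F k) <= (r / 2 ^+ K)%:E)%E.
Proof.
move=> mF h; have mU : measurable (\bigcup_k F k) by exact: bigcup_measurable.
apply: (le_trans (@measure_sigma_subadditive _ _ _ P (\bigcup_k F k) F mF mU (@subset_refl _ _))).
have /cvg_lim <- // := @cvg_geometric_eseries_half R r K.
by apply: lee_nneseries => k _ //; exact: h.
Qed.

End union_bounds.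

(** * Increments of spherical fractional Brownian motion *)
Section spherical_fBm_theory.
Context {R : realType} {d' : nat}.
Local Notation d := d'.+1.
Local Notation sph := (sphere R d).
Variable H : R.
Hypothesis H0 : 0 < H.
Hypothesis H12 : H <= 2^-1.
Context (disp : measure_display) (T : measurableType disp) (P : probability T R).
Variables (O : sph) (S : sph -> {RV P >-> R}).
Hypothesis fBm : spherical_fBm H O S.
Local Notation cov := (cov P).
Local Notation span := (span S).

Let contS : continuous_process S. Proof. by case: fBm. Qed.

Let gS : gaussian_process S. Proof. by case: fBm. Qed.

Let cS : centred_process S. Proof. by case: fBm. Qed.

Definition variogram (x y : sph) : R := geodist x y `^ (2 * H).

Let H2_01 : 0 <= 2 * H <= 1. Proof. by have := H0; have := H12 => ? ?; apply/andP; split; lra. Qed.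

Let variogram_xx x : variogram x x = 0.
Proof. by rewrite /variogram geodistxx powR0// mulf_neq0// gt_eqF. Qed.

Let variogramC x y : variogram x y = variogram y x.
Proof. by rewrite /variogram geodistC. Qed.

Let cov_S x y : cov (S x) (S y) = 2^-1 * (variogram x O + variogram y O - variogram x y).
Proof.
case: fBm => _ _ _ /(_ x y); rewrite unlock => e.
by rewrite /cov /Rintegral [X in fine X]e.
Qed.

Definition incr (p x : sph) (w : T) : R := S x w - S p w.

Let span_S x : span (S x). Proof. exact: span_gen. Qed.

Let span_incr p x : span (incr p x).
Proof. by apply: spanB. Qed.

Let cov_incr p x y : cov (incr p x) (incr p y) = 2^-1 * (variogram x p + variogram y p - variogram x y).
Proof.
rewrite (covBl gS cS)// !(covBr gS cS)//.
by rewrite !cov_S variogram_xx (variogramC p y); field.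
Qed.

(** The covariance of the increments depends on distances only, so every
isometry that maps p to O carries the increments from p to the field itself. *)
Lemma increment_law (J : finType) (p : sph) (rho : sph -> sph) (x : J -> sph) :
  (forall x y, sdot (rho x) (rho y) = sdot x y) -> rho p = O ->
  forall j k, cov (incr p (x j)) (incr p (x k)) = cov (S (rho (x j))) (S (rho (x k))).
Proof.
move=> hrho rp j k; rewrite cov_incr cov_S -rp.
by rewrite /variogram !(geodist_eq (hrho _ _)).
Qed.

Let seq_cvg (x : sph) (y : nat -> sph) w :
  (fun n => geodist x (y n)) @ \oo --> (0 : R) -> (fun n => S (y n) w) @ \oo --> S x w.
Proof. move=> /cvg_geodist h.
exact: (@cvg_comp _ _ _ y (fun t => S t w) _ _ _ h (contS (w := w) (x := x))). Qed.

(** By continuity of the paths, a bound along points converging to eta extends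
to eta. *)
Let le_of_approx (C : R) (eta : sph) (w : T) (c : R) :
  (forall n : nat, exists y, geodist eta y <= C / 2 ^+ n /\ S y w <= c) -> S eta w <= c.
Proof.
move=> approx; pose y n := sval (cid (approx n)).
have hy n : geodist eta (y n) <= C / 2 ^+ n /\ S (y n) w <= c by exact: svalP (cid (approx n)).
have lim : (fun n => S (y n) w) @ \oo --> S eta w.
  apply: seq_cvg; apply: (@squeeze_cvgr _ _ _ _ (cst 0) (geometric C 2^-1)).
  - apply: nearW => n /=; rewrite exprVn; have [-> _] := hy n.
    by rewrite andbT; have /andP[] := geodist_range eta (y n).
  - exact: cvg_cst.
  - by apply: cvg_geometric; rewrite gtr0_norm// invf_lt1// ltr1n.
move/cvg_lim : (lim) => <- //; apply: limr_le; last by apply: nearW => n; have [] := hy n.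
by apply/cvg_ex; exists (S eta w).
Qed.

Definition below (eps : R) : set T :=
  [set w | (ereal_sup [set (S eta w)%:E | eta in [set: sph]] < eps%:E)%E].

Let all_le_below (c eps : R) (w : T) : c < eps -> (forall eta, S eta w <= c) -> below eps w.
Proof.
move=> ce h; rewrite /below/=; apply: (@le_lt_trans _ _ c%:E); last by rewrite lte_fin.
by apply: ge_ereal_sup => _ [eta _ <-]; rewrite lee_fin.
Qed.

Let below_lt eps w eta : below eps w -> S eta w < eps.
Proof.
rewrite /below/= -lte_fin; apply: le_lt_trans.
by apply: ereal_sup_ubound; exists eta.
Qed.

(** A supremum strictly below eps leaves a gap of the form 1 / (m + 1); this
writes the event as a countable union. *)
Let below_all_le eps w : below eps w -> exists m : nat, forall eta, S eta w <= eps - m.+1%:R^-1.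
Proof.
move=> hw; have := hw; rewrite /below/=; set s := ereal_sup _ => hs.
have sge eta : ((S eta w)%:E <= s)%E by apply: ereal_sup_ubound; exists eta.
have [r sr] : exists r : R, s = r%:E.
  move: hs (sge O); case: s {sge} => [r _ _|//|]; first by exists r.
  by rewrite leeNy_eq.
move: hs sge; rewrite sr lte_fin => re sge.
have er0 : 0 < eps - r by rewrite subr_gt0.
have [m hm] : exists m : nat, m.+1%:R^-1 <= eps - r.
  exists (Num.truncn (eps - r)^-1); rewrite invf_ple ?posrE//.
  by apply: ltW; exact: truncnS_gt.
exists m => eta; have := sge eta; rewrite lee_fin => /le_trans; apply.
by rewrite lerBrDr addrC -lerBrDr.
Qed.

Let nets : exists (C : R) (J : nat -> finType) (q : forall n, J n -> sph), 0 < C /\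
  forall n, #|J n|%:R <= C * (2 ^+ n) ^+ d' /\
    forall eta, exists j, geodist eta (q n j) <= C / 2 ^+ n.
Proof.
have [C [C0 hC]] := @net_exists R d' O.
have hJ : forall n : nat, exists JQ : {J : finType & J -> sph},
    #|projT1 JQ|%:R <= C * (2 ^+ n) ^+ d' /\
    forall eta, exists j, geodist eta (projT2 JQ j) <= C / 2 ^+ n.
  by move=> n; have [|J [q h]] := hC (2 ^ n)%N; [rewrite expn_gt0|exists (existT _ J q); rewrite -natrX].
pose JQ n := sval (cid (hJ n)); have hJQ n := svalP (cid (hJ n)).
by exists C, (fun n => projT1 (JQ n)), (fun n => projT2 (JQ n)).
Qed.

Let mS x : measurable_fun [set: T] (S x). Proof. by []. Qed.

(** By continuity the uncountable supremum is controlled by its values on the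
countable union of the nets. *)
Lemma measurable_below eps : measurable (below eps).
Proof.
have [C [J [q [C0 net]]]] := nets.
rewrite (_ : below eps = \bigcup_m \bigcap_n
    [set w | forall j, S (q n j) w <= eps - m.+1%:R^-1]).
  apply: bigcup_measurable => m _; apply: bigcap_measurableType => n _.
  by apply: (@measurable_all_le _ _ (fun=> eps - m.+1%:R^-1) _ _ (fun j => S (q n j))).
apply/seteqP; split => w.
  by move=> /below_all_le[m hm]; exists m => // n _ j.
move=> [m _ hm]; apply: (@all_le_below (eps - m.+1%:R^-1)).
  by rewrite ltrBlDr ltrDl invr_gt0.
move=> eta; apply: (@le_of_approx C) => n.
by have [_ /(_ eta)[j hj]] := net n; exists (q n j); split => //; exact: hm.
Qed.

Lemma le_below e1 e2 : e1 <= e2 -> (P (below e1) <= P (below e2))%E.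
Proof.
move=> e12; apply: le_measure; rewrite ?inE; [exact: measurable_below..|].
by move=> w; rewrite /below/= => /lt_le_trans; apply; rewrite lee_fin.
Qed.

(** * Upper bound *)
(** The constant of [test_variable_exists]: a distance x + r / 2 in place of
x + r saves (1 - 2^(-2H)) r^(2H) in the subadditive bound on its power 2H. *)
Definition tilt_gain : R := (1 - 2 `^ (- (2 * H))) / 4.

Let tilt_gain_gt0 : 0 < tilt_gain.
Proof.
by rewrite divr_gt0// subr_gt0 powR2N_lt1// mulr_gt0.
Qed.

Let powR_half (r : R) : 0 <= r -> (r / 2) `^ (2 * H) = r `^ (2 * H) * 2 `^ (- (2 * H)).
Proof. by move=> r0; rewrite powRM// -powR_inv1// -powRrM mulN1r. Qed.

(** Z is the mean of the increments from p to two opposite points z and z' at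
distance r.  Its covariance with the increment from p to x is
(D(x, p) + r^(2H)) / 2 - (D(x, z) + D(x, z')) / 4, where D is the power 2H of the
distance.  Bounding both distances by dist(x, p) + r would only show that this
is nonnegative; [test_points_exist] improves one of them to dist(x, p) + r / 2,
and the gain is a multiple of r^(2H), uniformly in x.  The variance of Z is at
most r^(2H). *)
Lemma test_variable_exists (hd : (1 <= d')%N) (p : sph) (r : R) : 0 < r <= 2^-1 ->
  exists Z : T -> R, [/\ span Z, 0 < cov Z Z &
    forall x, r <= geodist x p ->
      tilt_gain * r `^ H * Num.sqrt (cov Z Z) <= cov (incr p x) Z].
Proof.
move=> /andP[r0 r12].
have [|z [z' [h1 h2 h3 h4]]] := @test_points_exist R d p r hd; first by rewrite r0.
pose Z w := 2^-1 * incr p z w + 2^-1 * incr p z' w.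
have sZ : span Z by apply: spanD; apply: spanZ.
have rho0 : 0 < r `^ (2 * H) by exact: powR_gt0.
have DzzE : variogram z z' <= r `^ (2 * H) + r `^ (2 * H).
  rewrite /variogram h3 (_ : 2 * r = r + r); last by ring.
  by apply: powR_subadditive => //; exact: ltW.
have Dzz0 : 0 <= variogram z z' by exact: powR_ge0.
have covZ : cov Z Z = r `^ (2 * H) - variogram z z' / 4.
  have sz u : span (fun w => 2^-1 * incr p u w) by exact: spanZ.
  rewrite (covDl gS cS)// !(covDr gS cS)// !(covZl gS cS)// !(covZr gS cS)//.
  by rewrite !cov_incr !variogram_xx (variogramC z' z) /variogram h1 h2 -/(variogram z z'); field.
exists Z; split => //; first by rewrite covZ; lra.
move=> x rx.
have rh : r `^ H * r `^ H = r `^ (2 * H).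
  by rewrite -powRD ?(gt_eqF r0) ?implybT//; congr (_ `^ _); ring.
have sqZ : Num.sqrt (cov Z Z) <= r `^ H.
  rewrite -(ger0_norm (powR_ge0 r H)) -sqrtr_sqr expr2 rh ler_wsqrtr// covZ; lra.
have tilt_gain_r : 0 <= tilt_gain * r `^ H by rewrite mulr_ge0 ?powR_ge0 ?ltW.
apply: (@le_trans _ _ (tilt_gain * r `^ (2 * H))).
  by rewrite -rh mulrA ler_wpM2l.
have x0 : 0 <= geodist x p by apply: le_trans rx; exact: ltW.
have covE : cov (incr p x) Z = 2^-1 * (variogram x p + r `^ (2 * H)) - (variogram x z + variogram x z') / 4.
  rewrite (covDr gS cS)//; try exact: spanZ.
  by rewrite !(covZr gS cS)// !cov_incr /variogram h1 h2 -!/(variogram _ _); field.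
have near_ y : geodist x y <= geodist x p + r / 2 -> variogram x y <= variogram x p + (1 - 4 * tilt_gain) * r `^ (2 * H).
  move=> hy; have /andP[y0 _] := geodist_range x y.
  apply: (@le_trans _ _ ((geodist x p + r / 2) `^ (2 * H))).
    by apply: ge0_le_powR => //; case/andP: H2_01.
  apply: (le_trans (powR_subadditive _ _ _)) => //; first by rewrite divr_ge0// ltW.
  by rewrite -/(variogram x p) powR_half ?(ltW r0)// /tilt_gain lerD2l le_eqVlt; apply/orP; left; apply/eqP; field.
have far y : geodist x y <= geodist x p + r -> variogram x y <= variogram x p + r `^ (2 * H).
  move=> hy; have /andP[y0 _] := geodist_range x y.
  apply: (@le_trans _ _ ((geodist x p + r) `^ (2 * H))).
    by apply: ge0_le_powR => //; case/andP: H2_01.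
  by apply: powR_subadditive => //; exact: ltW.
rewrite covE; case: (h4 x rx) => -[/near_ a /far b]; lra.
Qed.

Definition pbelow eps : R := fine (P (below eps)).

Let P_below eps : P (below eps) = (pbelow eps)%:E.
Proof. by rewrite /pbelow fineK//; apply: fin_num_measure; exact: measurable_below. Qed.

Let le_pbelow e1 e2 : e1 <= e2 -> pbelow e1 <= pbelow e2.
Proof. by move=> e12; rewrite -lee_fin -!P_below; exact: le_below. Qed.

(** Points at mutual distances 1 / (n d) make the level eps = grid_level n^(-H)
half of the shift tilt_gain (1 / (n d))^H of [test_variable_exists]. *)
Definition grid_level : R := tilt_gain / 2 * d%:R `^ (- H).

Let grid_level_gt0 : 0 < grid_level.
Proof. by rewrite mulr_gt0 ?powR_gt0 ?ltr0n// divr_gt0. Qed.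

(** For each grid point x_i, the event that the field stays below eps is
dominated, through a reflection and [gaussian_shift], by K times the probability
that x_i beats all the other grid points, plus the error term.  The latter
events are disjoint.  Sum over i. *)
Lemma grid_bound (n m : nat) (K : R) : (1 <= d')%N -> (0 < n)%N -> 0 < K ->
  n%:R ^+ d' * pbelow (grid_level * n%:R `^ (- H)) <=
  K + n%:R ^+ d' * (expR ((m.+1%:R ^+ 2 - m.+1%:R) / 2) * K ^- m).
Proof.
move=> hd n0 K0; set C := expR _ * _.
have [x sep] := @separated_exists R d' n n0.
pose r : R := (n%:R * d%:R)^-1.
have nd0 : 0 < n%:R * d%:R :> R by rewrite mulr_gt0// ltr0n.
have r0 : 0 < r by rewrite invr_gt0.
have r12 : r <= 2^-1.
  by rewrite lef_pV2 ?posrE// -natrM ler_nat (leq_trans _ (leq_pmull _ n0)).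
have -> : grid_level * n%:R `^ (- H) = tilt_gain / 2 * r `^ H.
  have rE : r `^ H = n%:R `^ (- H) * d%:R `^ (- H).
    by rewrite /r -powR_inv1 ?(ltW nd0)// -powRrM mulN1r powRM.
  by rewrite /grid_level rE; ring.
set eps := tilt_gain / 2 * r `^ H.
have eps0 : 0 < eps by rewrite mulr_gt0 ?powR_gt0// divr_gt0.
pose F i := [set w | forall j : {j | j != i}, incr (x i) (x (val j)) w <= - (eps / 2)].
have mF i : measurable (F i).
  apply: (@measurable_all_le _ _ (fun=> - (eps / 2)) _ _ (fun j : {j | j != i} => incr (x i) (x (val j)))) => j.
  exact: span_measurable (span_incr _ _).
have bound i : (P (below eps) <= K%:E * P (F i) + C%:E)%E.
  have [Z [sZ Z0 hZ]] := @test_variable_exists hd (x i) r (introT andP (conj r0 r12)).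
  have [rho [hrho rhoK rhoi]] := reflection_exists (x i) O.
  apply: (@le_trans _ _ (P [set w | forall j : {j | j != i}, S (rho (x (val j))) w < eps])).
    apply: le_measure; rewrite ?inE; first exact: measurable_below.
      exact: (@measurable_all_lt _ _ (fun=> eps) _ _ (fun j : {j | j != i} => S (rho (x (val j))))).
    by move=> w hw j; exact: below_lt.
  apply: (gaussian_shift gS cS (U := fun j : {j | j != i} => incr (x i) (x (val j)))
    (V := fun j => S (rho (x (val j)))) (Z := Z)) => //.
  - by move=> j k; exact: increment_law.
  - move=> j; rewrite (_ : 2 * eps = tilt_gain * r `^ H); last by rewrite /eps; field.
    apply: hZ; apply: sep; exact: valP j.
have sumF : (\sum_i P (F i) <= 1)%E.
  apply: sum_disjoint_probability_le1 => // i j w Fi Fj.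
  apply: contrapT => /eqP ij; have ji := ij; rewrite eq_sym in ji.
  have := Fi (exist _ j ji); have := Fj (exist _ i ij); rewrite /incr/=; lra.
pose f i := fine (P (F i)).
have fE i : P (F i) = (f i)%:E by rewrite /f fineK//; exact: fin_num_measure.
have sumf : \sum_i f i <= 1.
  by rewrite -lee_fin -sumEFin; under eq_bigr do rewrite -fE.
have boundf i : pbelow eps <= K * f i + C.
  by rewrite -lee_fin EFinD EFinM -fE -P_below.
have -> : n%:R ^+ d' = \sum_(i : {ffun 'I_d' -> 'I_n}) 1 :> R.
  by rewrite sumr_const card_ffun !card_ord natrX.
rewrite !mulr_suml; apply: (@le_trans _ _ (\sum_(i : {ffun 'I_d' -> 'I_n}) (K * f i + C))).
  by apply: ler_sum => i _; rewrite mul1r.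
rewrite big_split/= -mulr_sumr; under [X in _ <= _ + X]eq_bigr do rewrite mul1r.
by rewrite lerD2r ler_piMr// ltW.
Qed.

(** With N = n^d' grid points take K = N^kappa, where
kappa = 1 - theta H / d', and m >= 1 / kappa, so that K / N = n^(- theta H)
and the error K^(-m) <= 1 / N are both at most n^(- theta H).  The integer n is
then adapted to eps. *)
Lemma upper_bound (theta : R) : (1 <= d')%N -> 0 < theta -> theta < d'%:R / H ->
  exists C e0 : R, [/\ 0 < C, 0 < e0 & forall eps, 0 < eps -> eps <= e0 ->
    pbelow eps <= C * eps `^ theta].
Proof.
move=> hd th0 thH; have d0 : 0 < d'%:R :> R by rewrite ltr0n.
pose kappa : R := 1 - theta * H / d'%:R.
have k0 : 0 < kappa by rewrite subr_gt0 ltr_pdivrMr// mul1r -ltr_pdivlMr.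
have k1 : kappa < 1 by rewrite ltrBlDr ltrDl divr_gt0// mulr_gt0.
have [m hm] : exists m : nat, 1 <= kappa * m%:R.
  exists (Num.truncn kappa^-1).+1; rewrite mulrC -ler_pdivrMr// div1r ltW//.
  exact: truncnS_gt.
pose Cm : R := expR ((m.+1%:R ^+ 2 - m.+1%:R) / 2).
have Cm0 : 0 < Cm by exact: expR_gt0.
have grid n : (0 < n)%N -> pbelow (grid_level * n%:R `^ (- H)) <= (1 + Cm) * n%:R `^ (- (theta * H)).
  move=> n0; have n0' : 0 < n%:R :> R by rewrite ltr0n.
  have [N ND] : exists N : R, N = n%:R `^ d'%:R by eexists.
  have NE : N = n%:R ^+ d' by rewrite ND powR_mulrn// ltW.
  have N1 : 1 <= N by rewrite NE exprn_ege1// ler1n.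
  have N0 : 0 < N by exact: lt_le_trans N1.
  have := @grid_bound n m (N `^ kappa) hd n0 (powR_gt0 _ N0); rewrite -NE -/Cm.
  rewrite mulrC -ler_pdivlMr// => /le_trans; apply.
  set Y := Cm / _; rewrite (_ : (N `^ kappa + N * Y) / N = N `^ kappa / N + Y); last first.
    by field; rewrite gt_eqF.
  rewrite [leRHS]mulrDl mul1r {}/Y.
  have e1 : N `^ kappa / N = n%:R `^ (- (theta * H)).
    rewrite -[X in _ / X]powRr1 ?(ltW N0)// -powRB; last by rewrite (gt_eqF N0) implybT.
    rewrite ND -powRrM; congr (_ `^ _); rewrite /kappa; field; by rewrite gt_eqF.
  rewrite e1 lerD2l ler_wpM2l ?(ltW Cm0)// -e1.
  rewrite -[leLHS]mul1r ler_pdivrMr ?exprn_gt0 ?powR_gt0// mulrAC ler_pdivlMr// mul1r.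
  rewrite -powR_mulrn ?powR_ge0// -!powRrM -[leLHS]powRr1 ?(ltW N0)// -powRD; last by rewrite (gt_eqF N0) implybT.
  by apply: ler_powR => //; lra.
exists ((1 + Cm) * (2^-1 * grid_level `^ H^-1) `^ (- (theta * H))), grid_level; split => //.
  by rewrite mulr_gt0 ?powR_gt0 ?mulr_gt0 ?powR_gt0 ?addr_gt0.
move=> eps e0 ec; pose X : R := (grid_level / eps) `^ H^-1.
have X1 : 1 <= X.
  have e : 1 `^ H^-1 = 1 :> R by rewrite powR1.
  rewrite -[leLHS]e; apply: ge0_le_powR; rewrite ?invr_ge0 ?(ltW H0)//.
  by rewrite ler_pdivlMr// mul1r.
have X0 : 0 < X by exact: lt_le_trans X1.
have /andP[nX Xn] := truncn_itv (ltW X0).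
set n := Num.truncn X in nX Xn.
have n0 : (0 < n)%N by rewrite /n truncn_gt0.
have n0' : 0 < n%:R :> R by rewrite ltr0n.
apply: (@le_trans _ _ (pbelow (grid_level * n%:R `^ (- H)))).
  apply: le_pbelow; rewrite powRN ler_pdivlMr ?powR_gt0// mulrC -ler_pdivlMr//.
  have : n%:R `^ H <= X `^ H by apply: ge0_le_powR; rewrite ?(ltW H0).
  by rewrite /X -powRrM mulVf ?gt_eqF// powRr1// divr_ge0// ltW.
apply: le_trans (grid n n0) _; rewrite -mulrA ler_wpM2l ?addr_ge0 ?(ltW Cm0)//.
have -> : eps `^ theta = (eps `^ (- H^-1)) `^ (- (theta * H)).
  by rewrite -powRrM; congr (_ `^ _); field; rewrite gt_eqF.
rewrite -powRM ?mulr_ge0 ?powR_ge0//.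
have -> : 2^-1 * grid_level `^ H^-1 * eps `^ (- H^-1) = 2^-1 * X.
  rewrite /X powRM ?invr_ge0 ?(ltW e0) ?(ltW grid_level_gt0)// -mulrA; congr (_ * (_ * _)).
  by rewrite -(powR_inv1 (ltW e0)) -powRrM mulN1r.
have X2 : 2^-1 * X <= n%:R.
  have : n.+1%:R <= 2 * n%:R :> R by rewrite -natrM ler_nat mul2n -addnn -addn1 leq_add2l.
  lra.
rewrite !powRN lef_pV2 ?posrE ?powR_gt0 ?mulr_gt0//.
by apply: ge0_le_powR => //; rewrite ltW ?mulr_gt0.
Qed.

(** * Lower bound *)
Let incr_tail (x y : sph) (lambda : R) (m : nat) : 0 < lambda ->
  (P [set w | lambda <= `|S x w - S y w|]%R <=
   ((\prod_(i < m) (i.*2).+1)%:R * (variogram x y) ^+ m / lambda ^+ m.*2)%:E)%E.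
Proof.
move=> l0; have := @span_tail _ _ _ P _ S gS cS (incr y x) lambda m (span_incr y x) l0.
by rewrite cov_incr variogram_xx subr0 (_ : 2^-1 * _ = variogram x y)//; field.
Qed.

(** A triangle inequality up to a constant, which is all that chaining requires;
it follows from comparing arcs with coordinates. *)
Let quasi_triangle (x y z : sph) : geodist x z <= 2 * (d%:R * (geodist x y + geodist y z)).
Proof.
have /andP[a0 _] := geodist_range x y; have /andP[b0 _] := geodist_range y z.
apply: geodist_le_sqr; first by rewrite mulr_ge0 ?addr_ge0.
apply: (@le_trans _ _ (\sum_(i < d) (geodist x y + geodist y z) ^+ 2)).
  apply: ler_sum => i _; rewrite !mxE -expr2 -real_normK ?num_real//.
  rewrite lerXn2r ?nnegrE ?addr_ge0//.
  have := coord_le_geodist x y i; have := coord_le_geodist y z i.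
  rewrite (_ : set_val x 0 i - set_val z 0 i = (set_val x 0 i - set_val y 0 i) + (set_val y 0 i - set_val z 0 i)); last by ring.
  move=> h1 h2; apply: le_trans (ler_normD _ _) _; exact: lerD.
rewrite sumr_const card_ord -[leLHS]mulr_natl exprMn ler_wpM2r ?sqr_ge0//.
by rewrite -natrX ler_nat expnS leq_pmulr// expn1.
Qed.

Let measurable_incr_le (J : nat -> finType) (q : forall n, J n -> sph) (x : sph) (e : R) :
  measurable [set w | forall n j, incr x (q n j) w <= e].
Proof.
rewrite (_ : mkset _ = \bigcap_n [set w | forall j, incr x (q n j) w <= e]).
  apply: bigcap_measurableType => n _.
  apply: (@measurable_all_le _ _ (fun=> e) _ _ (fun j => incr x (q n j))) => j.
  exact: span_measurable (span_incr _ _).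
by apply/seteqP; split => w /= h n; [move=> _ j|]; exact: h.
Qed.

(** The field seen from x has the law of the field itself, transported by a
reflection which maps the nets to sets that are again dense.  Only finitely many
levels are compared at a time; the closed orthants of level 3/2 e absorb the
change from open to closed, and twice e makes the last inequality strict. *)
Let net_sup (J : nat -> finType) (q : forall n, J n -> sph) (C : R)
  (x : sph) (e : R) :
  (forall n eta, exists j, geodist eta (q n j) <= C / 2 ^+ n) -> 0 < e ->
  (P [set w | forall n j, incr x (q n j) w <= e]%R <= P (below (2 * e)))%E.
Proof.
move=> net e0; have [rho [hrho rhoK rhox]] := reflection_exists x O.
pose V m := [set w | forall t : {n : 'I_m & J n}, S (rho (q (tag t) (tagged t))) w <= 3 / 2 * e].
have mV m : measurable (V m).
  exact: (@measurable_all_le _ _ (fun=> 3 / 2 * e) _ _ (fun t : {n : 'I_m & J n} => S (rho (q (tag t) (tagged t))))).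
have mcapV : measurable (\bigcap_m V m) by exact: bigcap_measurableType.
have limV : (P \o V) m @[m --> \oo] --> P (\bigcap_m V m).
  apply: nonincreasing_cvg_mu => //.
    by apply: (@le_lt_trans _ _ 1%E); [exact: probability_le1|exact: ltry].
  move=> m1 m2 m12; apply/subsetPset => w hw t.
  by have := hw (Tagged (fun n : 'I_m2 => J n) (i := widen_ord m12 (tag t)) (tagged t)).
have leV m : (P [set w | forall n j, incr x (q n j) w <= e]%R <= P (V m))%E.
  apply: (@le_trans _ _ (P [set w | forall t : {n : 'I_m & J n}, incr x (q (tag t) (tagged t)) w < 3 / 2 * e]%R)).
    apply: le_measure; rewrite ?inE.
    - exact: measurable_incr_le.
    - apply: (@measurable_all_lt _ _ (fun=> 3 / 2 * e) _ _ (fun t : {n : 'I_m & J n} => incr x (q (tag t) (tagged t)))) => t.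
      exact: span_measurable (span_incr _ _).
    - by move=> w h t; apply: le_lt_trans (h _ _) _; lra.
  apply: (span_compare gS cS (U := fun t : {n : 'I_m & J n} => incr x (q (tag t) (tagged t)))
    (V := fun t => S (rho (q (tag t) (tagged t)))) (fun=> 3 / 2 * e)) => //.
  exact: (@increment_law _ x rho (fun t : {n : 'I_m & J n} => q (tag t) (tagged t)) hrho rhox).
apply: (@le_trans _ _ (P (\bigcap_m V m))).
  by move/cvg_lim : (limV) => <- //; apply: lime_ge; [apply/cvg_ex; eexists; exact: limV|exact: nearW].
apply: le_measure; rewrite ?inE//; first exact: measurable_below.
move=> w hw; apply: (@all_le_below (3 / 2 * e)); first by lra.
move=> eta; apply: (@le_of_approx C) => n.
have [j hj] := net n (rho eta); exists (rho (q n j)); split.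
  rewrite (geodist_eq (x' := rho eta) (y' := q n j))//.
  by rewrite -hrho rhoK.
exact: (hw n.+1 I (Tagged (fun n : 'I_n.+1 => J n) (i := ord_max) j)).
Qed.

Definition rough (kappa C : R) (J : nat -> finType) (q : forall n, J n -> sph) (k : nat) : set T :=
  [set w | exists ij : J k * J k.+1,
    geodist (q k ij.1) (q k.+1 ij.2) <= C / 2 ^+ k /\
    (2 ^+ k) `^ (- kappa) <= `|S (q k ij.1) w - S (q k.+1 ij.2) w|].

(** A moment of order 2m gives each pair of the two nets a probability of order
2^(- 2 (H - kappa) m k).  For 2 (H - kappa) m >= 2 d' + 1 this beats the number of
pairs, of order 2^(2 d' k), by a factor 2^(- k). *)
Lemma rough_probability (kappa C N : R) (J : nat -> finType) (q : forall n, J n -> sph) :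
  kappa < H -> 0 <= C -> 0 <= N -> (forall n, #|J n|%:R <= N * (2 ^+ n) ^+ d') ->
  exists M : R, 0 < M /\ forall k, measurable (rough kappa C q k) /\
    (P (rough kappa C q k) <= (M / 2 ^+ k)%:E)%E.
Proof.
move=> kH C0 N0 card.
have [m hm] : exists m : nat, d'.*2.+1%:R <= 2 * (H - kappa) * m%:R.
  have g0 : 0 < 2 * (H - kappa) by rewrite mulr_gt0// subr_gt0.
  exists (Num.truncn (d'.*2.+1%:R / (2 * (H - kappa)))).+1; rewrite mulrC -ler_pdivrMr//.
  by rewrite ltW// truncnS_gt.
pose G : R := (\prod_(i < m) (i.*2).+1)%:R.
pose M : R := N * N * 2 ^+ d' * (G * C `^ (2 * H * m%:R)).
have G0 : 0 <= G by [].
have M0 : 0 <= M by rewrite !mulr_ge0 ?powR_ge0 ?exprn_ge0.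
exists (1 + M); split; first by rewrite ltr_pwDl.
move=> k; have [t tE] : exists t : R, t = 2 ^+ k by eexists.
have t1 : 1 <= t by rewrite tE exprn_ege1// ler1n.
have t0 : 0 < t by exact: lt_le_trans t1.
pose F (ij : J k * J k.+1) : set T :=
  if geodist (q k ij.1) (q k.+1 ij.2) <= C / t
  then [set w | t `^ (- kappa) <= `|S (q k ij.1) w - S (q k.+1 ij.2) w|] else set0.
have mF ij : measurable (F ij).
  rewrite /F; case: ifP => // _.
  have mB : measurable_fun [set: T] (fun w => `|S (q k ij.1) w - S (q k.+1 ij.2) w|).
    by apply: measurableT_comp => //; exact: measurable_funB.
  by rewrite -[X in measurable X]setTI; apply: (@measurable_fun_le _ _ _ setT (fun=> t `^ (- kappa)) _).
have PF ij : (P (F ij) <= (G * (C `^ (2 * H * m%:R) / t ^+ d'.*2.+1))%:E)%E.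
  rewrite /F; case: ifP => [hg|_]; last first.
    by rewrite measure0 lee_fin !mulr_ge0 ?powR_ge0// invr_ge0 exprn_ge0// ltW.
  apply: (le_trans (incr_tail _ _ m _)); first exact: powR_gt0.
  rewrite lee_fin -mulrA ler_wpM2l// /variogram.
  have /andP[g0 _] := geodist_range (q k ij.1) (q k.+1 ij.2).
  rewrite -powR_mulrn ?powR_ge0// -powRrM -powR_mulrn ?powR_ge0// -powRrM.
  have HH : 0 <= 2 * H * m%:R by rewrite !mulr_ge0// ltW.
  apply: (@le_trans _ _ ((C / t) `^ (2 * H * m%:R) / t `^ (- kappa * m.*2%:R))).
    by rewrite ler_wpM2r ?invr_ge0 ?powR_ge0//; exact: ge0_le_powR.
  rewrite powRM ?invr_ge0 ?(ltW t0)// -mulrA ler_wpM2l ?powR_ge0//.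
  rewrite -powR_inv1 ?(ltW t0)// -powRrM -powRN -powRD; last by rewrite (gt_eqF t0) implybT.
  rewrite -[t ^+ _]powR_mulrn ?(ltW t0)// -powRN; apply: ler_powR => //.
  by rewrite -[m.*2]mul2n natrM; lra.
have [mU PU] := finite_union_bound P mF.
have -> : rough kappa C q k = [set w | exists ij, F ij w].
  apply/seteqP; split => w; rewrite /rough/= -tE.
    by move=> [ij [h1 h2]]; exists ij; rewrite /F h1.
  by move=> [ij]; rewrite /F; case: ifP => // h1 h2; exists ij.
split => //; apply: (le_trans PU).
apply: (@le_trans _ _ (\sum_(ij : J k * J k.+1) (G * (C `^ (2 * H * m%:R) / t ^+ d'.*2.+1))%:E)%E).
  by apply: lee_sum => ij _.
rewrite sumEFin lee_fin sumr_const -(mulr_natl _ #|_|) card_prod natrM -tE.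
have card1 := card k; have card2 := card k.+1; rewrite -tE in card1.
rewrite exprS -tE exprMn in card2.
have cc : #|J k|%:R * #|J k.+1|%:R <= (N * t ^+ d') * (N * (2 ^+ d' * t ^+ d')) by exact: ler_pM.
have X0 : 0 <= G * (C `^ (2 * H * m%:R) / t ^+ d'.*2.+1).
  by rewrite !mulr_ge0 ?powR_ge0// invr_ge0 exprn_ge0// ltW.
apply: le_trans (ler_wpM2r X0 cc) _.
rewrite [leLHS](_ : _ = M / t).
  by rewrite ler_pM2r ?invr_gt0// lerDr.
rewrite /M exprS -addnn exprD; field.
by rewrite gt_eqF// gt_eqF// exprn_gt0.
Qed.

(** From each eta follow nearest net points from level K on.  Consecutive points
are close, so each step changes S by less than 2^(- kappa k), and the steps add
up to a geometric series.  This bounds S(eta) by the value at a point of the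
K-th net, hence by the largest such value, taken at i. *)
Lemma chaining (kappa C : R) (J : nat -> finType) (q : forall n, J n -> sph) (K : nat) w :
  0 < kappa -> 0 <= C ->
  (forall n eta, exists j, geodist eta (q n j) <= C / 2 ^+ n) ->
  (forall k, (K <= k)%N -> ~ rough kappa (4 * d%:R * C) q k w) ->
  exists i, forall eta, S eta w <= S (q K i) w + (1 - 2 `^ (- kappa))^-1 * (2 ^+ K) `^ (- kappa).
Proof.
move=> k0 C0 net smooth.
have [b bE] : exists b : R, b = 2 `^ (- kappa) by eexists.
have b0 : 0 < b by rewrite bE powR_gt0.
have b1 : b < 1 by rewrite bE powR2N_lt1.
have bX k : (2 ^+ k) `^ (- kappa) = b ^+ k :> R.
  by rewrite bE -(powR_mulrn k (powR_ge0 _ _)) -(powR_mulrn k (ler0n R 2)) -!powRrM mulrC.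
have [j0 _] := net K O.
have [i _ imax] := Order.TotalTheory.arg_maxP (P := xpredT) (fun i => S (q K i) w) (i0 := j0) isT.
exists i => eta; rewrite -bE bX.
pose j n := sval (cid (net n eta)).
have hj n : geodist eta (q n (j n)) <= C / 2 ^+ n by exact: svalP (cid (net n eta)).
have step k : (K <= k)%N -> S (q k.+1 (j k.+1)) w - S (q k (j k)) w <= b ^+ k.
  move=> /smooth nr; rewrite leNgt; apply/negP => gt; apply: nr.
  exists (j k, j k.+1) => /=; split; last first.
    by rewrite bX distrC; apply: le_trans (ler_norm _); exact: ltW.
  apply: (le_trans (quasi_triangle _ eta _)).
  rewrite -[leRHS]mulrA -[leRHS]mulrA (_ : 4 = 2 * 2 :> R); last by rewrite -natrM.
  rewrite -[leRHS]mulrA ler_wpM2l// mulrCA ler_wpM2l//.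
  rewrite (geodistC (q k (j k))) mulrDl mul1r; apply: lerD; first exact: hj.
  apply: (le_trans (hj k.+1)); rewrite ler_wpM2l// lef_pV2 ?posrE ?exprn_gt0//.
  by rewrite ler_weXn2l// ler1n.
have b1n : 1 - b != 0 by rewrite subr_eq0 gt_eqF.
have sum n : S (q (K + n)%N (j (K + n)%N)) w <= S (q K (j K)) w + (1 - b)^-1 * (b ^+ K - b ^+ (K + n)).
  elim: n => [|n IH]; first by rewrite addn0 subrr mulr0 addr0.
  have := step (K + n)%N (leq_addr _ _); rewrite -addnS.
  rewrite (_ : b ^+ (K + n.+1) = b * b ^+ (K + n)); last by rewrite addnS exprS.
  have e : (1 - b)^-1 * (b ^+ K - b * b ^+ (K + n)) =
     (1 - b)^-1 * (b ^+ K - b ^+ (K + n)) + b ^+ (K + n) by field.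
  move=> h; rewrite e; lra.
apply: (@le_of_approx C) => n; exists (q (K + n)%N (j (K + n)%N)); split.
  apply: (le_trans (hj _)); rewrite ler_wpM2l// lef_pV2 ?posrE ?exprn_gt0//.
  by rewrite ler_weXn2l// ?ler1n// leq_addl.
apply: le_trans (sum n) _; apply: lerD; first exact: imax.
by rewrite ler_wpM2l ?invr_ge0 ?subr_ge0 ?(ltW b1)// gerBl exprn_ge0// ltW.
Qed.

(** The rough events of level at least K have total probability at most
2 M / 2^K <= 1/2.  Outside them one of the points of the K-th net satisfies the
event of [net_sup]. *)
Lemma dyadic_lower_bound (kappa : R) : 0 < kappa -> kappa < H ->
  exists A N : R, exists K0 : nat, [/\ 0 < A, 0 < N & forall K, (K0 <= K)%N ->
    2^-1 <= N * (2 ^+ K) ^+ d' * pbelow (A * (2 ^+ K) `^ (- kappa))].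
Proof.
move=> k0 kH; have [C [J [q [C0 netq]]]] := nets.
have net n eta : exists j, geodist eta (q n j) <= C / 2 ^+ n by have [_] := netq n; apply.
have card n : #|J n|%:R <= C * (2 ^+ n) ^+ d' by case: (netq n).
have C4 : 0 <= 4 * d%:R * C by rewrite !mulr_ge0// ltW.
have [M [M0 hM]] := @rough_probability kappa (4 * d%:R * C) C J q kH C4 (ltW C0) card.
pose A : R := (1 - 2 `^ (- kappa))^-1.
have A0 : 0 < A by rewrite invr_gt0 subr_gt0 powR2N_lt1.
exists (2 * A), C, (Num.truncn (4 * M)).+1; split; rewrite ?mulr_gt0// => K hK.
pose a : R := A * (2 ^+ K) `^ (- kappa).
have a0 : 0 < a by rewrite mulr_gt0// powR_gt0// exprn_gt0.
pose B := \bigcup_k rough kappa (4 * d%:R * C) q (K + k).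
have mB : measurable B by apply: bigcup_measurable => k _; case: (hM (K + k)%N).
have PB : (P B <= (2^-1)%:E)%E.
  apply: (@le_trans _ _ (2 * M / 2 ^+ K)%:E).
    apply: geometric_union_bound => k; first by case: (hM (K + k)%N).
    have [_ /le_trans] := hM (K + k)%N; apply.
    rewrite lee_fin natrX addnS (addnC k) exprS le_eqVlt; apply/orP; left; apply/eqP.
    by field; rewrite expf_neq0.
  rewrite lee_fin ler_pdivrMr ?exprn_gt0//.
  have h1 : 4 * M <= 2 ^+ K.
    apply: (@le_trans _ _ K%:R).
      by apply: le_trans (ltW (truncnS_gt _)) _; rewrite ler_nat.
    by rewrite -natrX ler_nat ltnW// ltn_expl.
  lra.
pose F i := [set w | forall n j, incr (q K i) (q n j) w <= a].
have mF i : measurable (F i) by exact: measurable_incr_le.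
have [mU PU] := finite_union_bound P mF.
have cov1 : ~` B `<=` [set w | exists i, F i w].
  move=> w nB; have [|i hi] := @chaining kappa C J q K w k0 (ltW C0) net.
    move=> k Kk rk; apply: nB; exists (k - K)%N => //; by rewrite subnKC.
  by exists i => n j; rewrite /incr lerBlDl hi.
have h1 : (1 - P B <= P [set w | exists i, F i w])%E.
  by rewrite -probability_setC//; apply: le_measure; rewrite ?inE//; exact: measurableC.
have h2 : (P [set w | exists i, F i w] <= (#|J K|%:R * pbelow (2 * a))%:E)%E.
  apply: (le_trans PU); apply: (@le_trans _ _ (\sum_(i : J K) (pbelow (2 * a))%:E)%E).
    by apply: lee_sum => i _; rewrite -P_below; apply: net_sup.
  by rewrite sumEFin lee_fin sumr_const -(mulr_natl _ #|_|).
have h3 : (2^-1 <= #|J K|%:R * pbelow (2 * a)).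
  rewrite -lee_fin; apply: le_trans (le_trans h1 h2).
  apply: (@le_trans _ _ (1 - (2^-1)%:E)%E); last by apply: leeB.
  by rewrite -EFinB lee_fin; lra.
apply: (le_trans h3); rewrite /a mulrA; apply: ler_wpM2r => //.
by rewrite /pbelow fine_ge0.
Qed.

(** Apply [dyadic_lower_bound] to the level K for which 2^(K - 1) is at most
X = (A / eps)^(1 / kappa) and 2^K at least X. *)
Lemma lower_bound (kappa : R) : 0 < kappa -> kappa < H ->
  exists c e0 : R, [/\ 0 < c, 0 < e0 & forall eps, 0 < eps -> eps <= e0 ->
    c * eps `^ (d'%:R / kappa) <= pbelow eps].
Proof.
move=> k0 kH; have [A [N [K0 [A0 N0 hK]]]] := dyadic_lower_bound k0 kH.
exists ((2 * N * 2 ^+ d' * A `^ (d'%:R / kappa))^-1), (A * (2 ^+ K0) `^ (- kappa)).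
have den0 : 0 < 2 * N * 2 ^+ d' * A `^ (d'%:R / kappa) by rewrite !mulr_gt0 ?powR_gt0 ?exprn_gt0.
split; rewrite ?invr_gt0// ?mulr_gt0 ?powR_gt0 ?exprn_gt0// => eps e0 el.
pose X : R := (A / eps) `^ kappa^-1.
have Ae : 0 < A / eps by rewrite divr_gt0.
have X0 : 0 < X by exact: powR_gt0.
have XK : 2 ^+ K0 <= X.
  have -> : 2 ^+ K0 = ((2 ^+ K0) `^ kappa) `^ kappa^-1 :> R.
    by rewrite -powRrM divff ?gt_eqF// powRr1.
  apply: ge0_le_powR; rewrite ?invr_ge0 ?(ltW k0) ?powR_ge0//.
  by move: el; rewrite powRN ler_pdivlMr ?powR_gt0 ?exprn_gt0// ler_pdivlMr// mulrC.
have X1 : 1 <= X by apply: le_trans XK; rewrite exprn_ege1// ler1n.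
have /andP[nX Xn] := truncn_itv (ltW X0); set n := Num.truncn X in nX Xn.
have n0 : (0 < n)%N by rewrite /n truncn_gt0.
have /andP[l1 l2] := trunc_log_bounds (isT : (1 < 2)%N) n0.
set K := (trunc_log 2 n).+1 in l2.
have XltK : X <= 2 ^+ K by apply: le_trans (ltW Xn) _; rewrite -natrX ler_nat.
have Kle : 2 ^+ K <= 2 * X.
  by rewrite exprS ler_wpM2l//; apply: le_trans nX; rewrite -natrX ler_nat.
have K0K : (K0 <= K)%N.
  by rewrite -(ler_eXn2l _ _ (x := 2 : R)) ?ltr1n//; exact: le_trans XltK.
have := hK K K0K.
set t : R := 2 ^+ K in XltK Kle *.
have t0 : 0 < t by exact: exprn_gt0.
have pe : pbelow (A * t `^ (- kappa)) <= pbelow eps.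
  apply: le_pbelow; rewrite powRN ler_pdivrMr ?powR_gt0// mulrC -ler_pdivrMr//.
  have -> : A / eps = X `^ kappa by rewrite /X -powRrM mulVf ?gt_eqF// powRr1// ltW.
  by apply: ge0_le_powR; rewrite ?(ltW k0) ?(ltW X0).
have pe0 : 0 <= pbelow eps by rewrite /pbelow fine_ge0.
move=> h; rewrite mulrC ler_pdivrMr//.
have XE : X ^+ d' * eps `^ (d'%:R / kappa) = A `^ (d'%:R / kappa).
  rewrite -powR_mulrn ?(ltW X0)// /X -powRrM (mulrC kappa^-1) -powRM ?(ltW Ae) ?(ltW e0)//.
  by rewrite divfK// gt_eqF.
rewrite -XE.
have ee0 : 0 < eps `^ (d'%:R / kappa) by exact: powR_gt0.
set E := eps `^ _ in ee0 *.
rewrite (_ : pbelow eps * _ = E * (2 * (N * (2 * X) ^+ d' * pbelow eps))); last by rewrite exprMn; ring.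
rewrite ler_peMr ?(ltW ee0)//.
have : N * t ^+ d' * pbelow (A * t `^ (- kappa)) <= N * (2 * X) ^+ d' * pbelow eps.
  apply: ler_pM => //; rewrite ?mulr_ge0 ?exprn_ge0 ?(ltW N0) ?(ltW t0)//; first by rewrite /pbelow fine_ge0.
  by rewrite ler_wpM2l ?(ltW N0)// lerXn2r ?nnegrE ?mulr_ge0 ?(ltW t0) ?(ltW X0).
lra.
Qed.

End spherical_fBm_theory.

(** * The exponent *)
(** After taking logarithms the constants C and c contribute ln C / ln eps and
ln c / ln eps, which vanish in the limit. *)
Lemma cvg_log_ratio (R : realType) (f : R -> R) (L : R) : 0 < L ->
  (forall theta, 0 < theta -> theta < L -> exists C e0 : R, [/\ 0 < C, 0 < e0 &
    forall eps, 0 < eps -> eps <= e0 -> f eps <= C * eps `^ theta]) ->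
  (forall tau, L < tau -> exists c e0 : R, [/\ 0 < c, 0 < e0 &
    forall eps, 0 < eps -> eps <= e0 -> c * eps `^ tau <= f eps]) ->
  ln (f eps) / ln eps @[eps --> 0^'+] --> L.
Proof.
move=> L0 up low; apply/cvgrPdist_lt => e e0.
pose h : R := Num.min (e / 2) (L / 2).
have h0 : 0 < h by rewrite lt_min !divr_gt0.
have hL : h <= L / 2 by rewrite ge_min lexx orbT.
have he : h <= e / 2 by rewrite ge_min lexx.
have [||C [e1 [C0 e10 hC]]] := up (L - h); [lra..|].
have [|c [e2 [c0 e20 hc]]] := low (L + h); first lra.
pose m : R := 2 * (`|ln C| + `|ln c| + 1) / e.
have m0 : 0 < m by rewrite divr_gt0// mulr_gt0// ltr_wpDl// addr_ge0.
pose u : R := Num.min (Num.min e1 e2) (expR (- m)).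
have u0 : 0 < u by rewrite !lt_min e10 e20 expR_gt0.
near=> eps.
have x0 : 0 < eps by near: eps; exact: nbhs_right_gt.
have xu : eps <= u by near: eps; exact: nbhs_right_le.
move: xu; rewrite !le_min => /andP[/andP[x1 x2] xm].
have lb := hc eps x0 x2; have ub := hC eps x0 x1.
have p1 : 0 < c * eps `^ (L + h) by rewrite mulr_gt0 ?powR_gt0.
have f0 : 0 < f eps by exact: lt_le_trans lb.
have lx : ln eps <= - m.
  by rewrite -[leRHS]expRK ler_ln ?posrE// expR_gt0.
move: lb ub; rewrite -ler_ln ?posrE// lnM ?posrE ?powR_gt0// ln_powR => lb.
rewrite -ler_ln ?posrE ?mulr_gt0 ?powR_gt0// lnM ?posrE ?powR_gt0// ln_powR => ub.
have lx0 : ln eps < 0 by apply: le_lt_trans lx _; rewrite oppr_lt0.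
have me : m * (e / 2) = `|ln C| + `|ln c| + 1 by rewrite /m; field; rewrite gt_eqF.
have key : `|ln C| + `|ln c| + 1 <= - ln eps * (e / 2).
  by rewrite -me ler_wpM2r ?divr_ge0 ?(ltW e0)// lerNr.
have hh : - ln eps * h <= - ln eps * (e / 2) by rewrite ler_wpM2l// oppr_ge0 ltW.
have aC := ler_norm (ln C); have ac := ler_norm (- ln c); rewrite normrN in ac.
have aC0 := normr_ge0 (ln C); have ac0 := normr_ge0 (ln c).
rewrite ltr_norml; apply/andP; split.
- rewrite ltrNl opprB ltrBlDr ltr_ndivrMr//; nra.
- rewrite ltrBlDr -ltrBlDl ltr_ndivlMr//; nra.
Unshelve. all: by end_near.
Qed.

Theorem theorem1p1 (R : realType) (d : nat) (hd : (2 <= d)%N)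
  (H : R) (hH0 : 0 < H) (hH : H <= 2^-1)
  (disp : measure_display) (T : measurableType disp) (P : probability T R)
  (O : sphere R d) (S : sphere R d -> {RV P >-> R})
  (hS : spherical_fBm H O S) :
  ln (fine (P [set w : T |
        (ereal_sup [set (S eta w)%:E | eta in [set: sphere R d]] < eps%:E)%E]))
    / ln eps
  @[eps --> 0^'+] --> (d.-1)%:R / H.
Proof.
case: d hd O S hS => // d' hd O S fBm.
have d0 : 0 < d'%:R :> R by rewrite ltr0n.
apply: (@cvg_log_ratio R (pbelow S)); first by rewrite divr_gt0.
- by move=> theta th0 thL; apply: (@upper_bound R d' H hH0 hH disp T P O S fBm).
- move=> tau tauL; have tau0 : 0 < tau by apply: lt_trans tauL; rewrite divr_gt0.
  have := @lower_bound R d' H hH0 disp T P O S fBm (d'%:R / tau).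
  rewrite invf_div mulrCA divff ?gt_eqF// mulr1; apply.
    by rewrite divr_gt0.
  by rewrite ltr_pdivrMr// mulrC -ltr_pdivrMr.
Qed.
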